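(* Let $\Omega\subset\mathbb R^n$ be a bounded domain, $1\le m\le n$, $Q=\Omega\times(0,\infty)$. Let $\mathbf u\in C^2(\bar\Omega)$ be $m$-admissible, $\mathbf f=T_m(\mathbf u_{xx})$, $\Phi=\mathbf u|_{\partial\Omega}$. Let $u\in C^{2,1}(Q)\cap C(\bar\Omega\times[0,\infty))$. Assume there is $(x_0,t_0)\in Q$ such that $u_{xx}(x_0,t_0)$ is $m$-positive, and constants $0<\nu\le\mu$ with $\nu\le E_m[u]\le\mu$ in $Q_0=\Omega\times[t_0,\infty)$. Assume there are continuous non-increasing functions $h_1^+,h_2^+,h^-:[t_0,\infty)\to(0,\infty)$ with $h_2^+(t_0)<\frac1m$ such that $-h^-(t_0)\le u(x,t_0)-\mathbf u(x)\le h_1^+(t_0)$ for $x\in\Omega$; $-h^-(t)\le u(x,t)-\Phi(x)\le h_1^+(t)$ for $x\in\partial\Omega$, $t\ge t_0$; and $-h^-(t)\le\frac1m\big(1-\frac{E_m[u]}{\mathbf f}\big)\le h_2^+(t)$ in $Q_0$. Then $\sup_{\bar\Omega\times[0,\infty)}|u|<\infty$. If in addition $h_1^+(t),h_2^+(t),h^-(t)\to0$ as $t\to\infty$, then $\sup_{x\in\bar\Omega}|u(x,t)-\mathbf u(x)|\to0$ as $t\to\infty$.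
   Context: For $S\in\mathrm{Sym}(n)$ and $0\le p\le n$, $T_p(S)$ is the sum of all principal $p\times p$ minors of $S$, with $T_0(S)=1$. $K_m=\{S\in\mathrm{Sym}(n):T_p(S)>0,\ p=1,\dots,m\}$; $S$ is $m$-positive if $S\in K_m$. A function $\mathbf u\in C^2(\bar\Omega)$ is $m$-admissible if $\mathbf u_{xx}(x)\in K_m$ for all $x\in\bar\Omega$. For $u(x,t)$, $u_{xx}$ is its Hessian in $x$ and $E_m[u]=-u_t\,T_{m-1}(u_{xx})+T_m(u_{xx})$. *)

(* Defs.v *)
From Stdlib Require Import Reals.
From mathcomp Require Import all_boot.

Set Implicit Arguments.
Unset Strict Implicit.
Unset Printing Implicit Defensive.

Local Open Scope R_scope.

Definition point (n : nat) := 'I_n -> R.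

Definition upd {n} (x : point n) (i : 'I_n) (s : R) : point n :=
  fun j => if j == i then s else x j.

(* open ball in the max norm (equivalent to the Euclidean topology) *)
Definition ball {n} (x : point n) (r : R) (y : point n) : Prop :=
  forall i, Rabs (y i - x i) < r.

Definition is_open {n} (O : point n -> Prop) : Prop :=
  forall x, O x -> exists r, 0 < r /\ forall y, ball x r y -> O y.

Definition is_connected {n} (O : point n -> Prop) : Prop :=
  forall U V : point n -> Prop, is_open U -> is_open V ->
    (forall x, O x -> U x \/ V x) ->
    (forall x, O x -> ~ (U x /\ V x)) ->
    (exists x, O x /\ U x) -> (exists x, O x /\ V x) -> False.

Definition is_domain {n} (O : point n -> Prop) : Prop :=
  (exists x, O x) /\ is_open O /\ is_connected O.

Definition is_bounded {n} (O : point n -> Prop) : Prop :=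
  exists M, forall x, O x -> forall i, Rabs (x i) <= M.

Definition clos {n} (O : point n -> Prop) (x : point n) : Prop :=
  forall r, 0 < r -> exists y, O y /\ ball x r y.

Definition boundary {n} (O : point n -> Prop) (x : point n) : Prop :=
  clos O x /\ ~ O x.

Definition cont_on {n} (S : point n -> Prop) (g : point n -> R) : Prop :=
  forall x, S x -> forall eps, 0 < eps -> exists delta, 0 < delta /\
    forall y, S y -> ball x delta y -> Rabs (g y - g x) < eps.

Definition cont_on2 {n} (S : point n -> R -> Prop) (g : point n -> R -> R) : Prop :=
  forall x t, S x t -> forall eps, 0 < eps -> exists delta, 0 < delta /\
    forall y s, S y s -> ball x delta y -> Rabs (s - t) < delta ->
      Rabs (g y s - g x t) < eps.

Definition Rsum (l : seq R) : R := foldr Rplus 0 l.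

Fixpoint rem_nth {T} (k : nat) (s : seq T) : seq T :=
  match s, k with
  | [::], _ => [::]
  | _ :: s', O => s'
  | x :: s', S k' => x :: rem_nth k' s'
  end.

(* determinant of the submatrix of A with rows [rows] and columns [cols]
   (Laplace expansion along the first row) *)
Fixpoint detL {n} (A : 'I_n -> 'I_n -> R) (rows : seq 'I_n) (cols : seq 'I_n)
  {struct rows} : R :=
  match rows with
  | [::] => 1
  | r :: rs =>
      match cols with
      | [::] => 0
      | c0 :: _ =>
        Rsum [seq (if odd k then -1 else 1) * A r (nth c0 cols k)
                   * detL A rs (rem_nth k cols) | k <- iota 0 (size cols)]
      end
  end.

Fixpoint subsets {T} (s : seq T) (p : nat) : seq (seq T) :=
  match p, s with
  | O, _ => [:: [::]]
  | S _, [::] => [::]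
  | S p', x :: s' => map (cons x) (subsets s' p') ++ subsets s' p
  end.

Definition Tp {n} (p : nat) (A : 'I_n -> 'I_n -> R) : R :=
  Rsum [seq detL A J J | J <- subsets (enum 'I_n) p].

Definition Km {n} (m : nat) (A : 'I_n -> 'I_n -> R) : Prop :=
  forall p, (1 <= p)%nat -> (p <= m)%nat -> 0 < Tp p A.

Definition tends_to_0_at_infty (h : R -> R) : Prop :=
  forall eps, 0 < eps -> exists T, forall t, T <= t -> Rabs (h t) < eps.

(* Main.v *)
(* Put W = diag(-u_t, u_xx), so that E_m[u] = T_m(W).  The polynomial
   det(I + X S) of a symmetric S is real-rooted and its coefficients are the
   T_k(S); this gives Newton's inequalities T_(k-1) T_(k+1) <= T_k^2 and, through
   rank-one perturbations in a basis diagonalizing S, the monotonicity of T_m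
   on the cone K_m.  By Newton, on K_m a lower bound T_m >= nu > 0 bounds every
   T_p (p <= m) away from 0, so "W lies in K_m" is a locally constant property
   on Q_0 and propagates from (x0, t0).

   Comparison at a maximum point then applies to u against
   v = (1 - g) bu + g M + d from above and v = (1 + g) bu - g M - d from below,
   where M >= bu and g(t) = ga + ka exp(- la (t - T)).  Constant g yields the
   bound; letting ga, d -> 0 with T -> oo yields the convergence. *)

Require Import Defs.
From Stdlib Require Import Reals Lra Classical FunctionalExtensionality.
From mathcomp Require Import all_boot all_order all_algebra complex Rstruct.
From mathcomp Require ring.
From mathcomp Require boolp classical_sets reals Rstruct_topology topology normedtype derive.

Set Implicit Arguments.
Unset Strict Implicit.
Unset Printing Implicit Defensive.

Delimit Scope R_scope with coqR.

(** * Real-rooted polynomials and principal minors *)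

(** The barrier is bu + g (M - bu) + d: its Hessian is a multiple of that of bu, so by homogeneity
    every T_p of it is an explicit power of 1 - g or 1 + g times T_p of the Hessian of bu, and the
    relative bound on E_m / f can be compared directly. On the boundary g (M - bu) >= 0, so d alone
    has to dominate the boundary error.

    A decaying g costs a time derivative, which enters E_m multiplied by (M - bu) T_(m-1). By
    compactness (M - bu) T_(p-1) <= L T_p, and a decay rate la with la L <= 1 keeps this cost below
    the gain from the transient part of g. The permanent part ga then only has to exceed m h2 or m
    hm.

    From above 1 - g must stay nonnegative, so g <= 1. For constant g this is possible because m
    h2(t0) < 1. For the convergence it means that a large gap at time T is covered by raising M, not
    by raising g.

    Monotonicity asks the smaller matrix to lie in the cone. From above that is W, which is why the
    cone has to be propagated; from below it is the matrix of the barrier, which is checked by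
    hand. *)

Section Minors.
Import ring.
Import Order.TTheory GRing.Theory Num.Theory.
Local Open Scope ring_scope.
Local Open Scope sesquilinear_scope.

Section RealRooted.
Variable C : numClosedFieldType.
Implicit Types (p q : {poly C}) (r : seq C).

Definition real_rooted p := forall z, root p z -> z \is Num.real.

Lemma real_rooted_splits p : real_rooted p ->
  exists2 r, p = lead_coef p *: \prod_(a <- r) ('X - a%:P) & {subset r <= Num.real}.
Proof.
move=> hp; have [p0|p0] := eqVneq p 0.
  by exists [::] => //; rewrite p0 lead_coef0 scale0r.
have [r pE] := closed_field_poly_normal p.
exists r => // a ar; apply: hp; rewrite pE rootE hornerZ.
by rewrite (eqP (_ : root _ a)) ?mulr0// root_prod_XsubC.
Qed.

Lemma deriv_prod_XsubC r z : z \notin r ->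
  (\prod_(a <- r) ('X - a%:P))^`().[z] =
  (\prod_(a <- r) ('X - a%:P)).[z] * \sum_(a <- r) (z - a)^-1.
Proof.
elim: r => [|a r IH]; first by rewrite !big_nil derivE horner0 mulr0.
rewrite inE negb_or => /andP[za /IH{}IH].
rewrite !big_cons derivM derivXsubC !hornerE IH.
by field; rewrite subr_eq0.
Qed.

(** Gauss-Lucas for the real line. The logarithmic derivative is studied off the real axis, so
    multiple roots are treated like simple ones. *)
Lemma real_rooted_deriv p : p^`() != 0 -> real_rooted p -> real_rooted p^`().
Proof.
move=> p'0 /real_rooted_splits[r pE rR] z rz; apply: contraT => zNR.
have c0 : lead_coef p != 0.
  by rewrite lead_coef_eq0; apply: contraNneq p'0 => ->; rewrite deriv0.
have zr : z \notin r by apply: contra zNR => /rR.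
have r0 : r != [::].
  by apply: contraNneq p'0 => r0; rewrite pE r0 big_nil alg_polyC derivC.
have Pz : (\prod_(a <- r) ('X - a%:P)).[z] != 0.
  by move: zr; rewrite -rootE root_prod_XsubC.
move: rz; rewrite pE derivZ rootE hornerZ deriv_prod_XsubC// !mulf_eq0.
rewrite (negPf c0) (negPf Pz) /= => /eqP S0.
(* p'/p = \sum 1/(z - a), whose imaginary part has the sign of - Im z. *)
have zz : z^* - z != 0.
  by rewrite subr_eq0; apply: contra zNR => /eqP; rewrite CrealE => ->.
have : \sum_(a <- r) (z - a)^-1 - (\sum_(a <- r) (z - a)^-1)^* =
       (z^* - z) * \sum_(a <- r) `|z - a| ^- 2.
  rewrite rmorph_sum -sumrB mulr_sumr !big_seq; apply: eq_bigr => a ar.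
  have za : z - a != 0 by rewrite subr_eq0; apply: contraNneq zr => ->.
  rewrite fmorphV /= normCK.
  have zac : (z - a)^* != 0 by rewrite conjC_eq0.
  have aR := conj_Creal (rR a ar).
  rewrite rmorphB /= aR in zac *.
  by field; rewrite zac za.
rewrite S0 conjC0 subr0 => /esym/eqP; rewrite mulf_eq0 (negPf zz) /=.
rewrite big_seq psumr_eq0 => [|a ar]; last by rewrite invr_ge0 exprn_ge0.
case: r r0 zr {pE rR Pz S0} => // a r _; rewrite inE negb_or => /andP[za _].
by rewrite /= inE eqxx /= invr_eq0 expf_eq0 /= normr_eq0 subr_eq0 (negPf za).
Qed.

(** A further root [a] turns the Laguerre form D of q into q(x)^2 + (x - a)^2 D. Realness of the
    value is carried along because a square is nonnegative only for a real number. *)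
Lemma laguerre_prod r x : {subset r <= Num.real} -> x \is Num.real ->
  let p := \prod_(a <- r) ('X - a%:P) in
  p.[x] \is Num.real /\ 0 <= p^`().[x] ^+ 2 - p.[x] * p^`()^`().[x].
Proof.
move=> + xR; elim: r => [|a r IH] rR /=.
  by rewrite !big_nil !derivE !hornerE subr0 exprn_ge0 ?real1.
have aR : a \is Num.real by apply: rR; rewrite mem_head.
have [|qR L] := IH; first by move=> b br; apply: rR; rewrite inE br orbT.
rewrite !big_cons; set q := \prod_(_ <- _) _ in qR L *.
have xaR : x - a \is Num.real by rewrite rpredB.
rewrite derivM derivXsubC mul1r derivD derivM derivXsubC mul1r !hornerE.
split; first by rewrite rpredM.
set y := q.[x] in qR L *; set y' := q^`().[x] in L *; set y'' := q^`()^`().[x] in L *.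
rewrite (_ : _ - _ = y ^+ 2 + (x - a) ^+ 2 * (y' ^+ 2 - y * y'')); last by rewrite /=; ring.
by rewrite addr_ge0 ?real_exprn_even_ge0// mulr_ge0 ?real_exprn_even_ge0.
Qed.

Lemma laguerre p x : real_rooted p -> p \is a polyOver Num.real -> x \is Num.real ->
  p.[x] * p^`()^`().[x] <= p^`().[x] ^+ 2.
Proof.
move=> /real_rooted_splits[r pE rR] pR xR; rewrite -subr_ge0 pE !derivZ !hornerZ.
set c := lead_coef p; have cR : c \is Num.real by rewrite /c lead_coefE (polyOverP pR).
have [_] := laguerre_prod rR xR; set q := \prod_(_ <- _) _ => L.
rewrite (_ : _ - _ = c ^+ 2 * (q^`().[x] ^+ 2 - q.[x] * q^`()^`().[x])); last by ring.
by rewrite mulr_ge0 ?real_exprn_even_ge0.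
Qed.

Lemma real_rooted_derivn p j : p^`(j) != 0 -> real_rooted p -> real_rooted p^`(j).
Proof.
elim: j => [|j IH]; rewrite ?derivn0// derivnS => pj hp.
apply: real_rooted_deriv => //; apply: IH => //.
by apply: contraNneq pj => ->; rewrite deriv0.
Qed.

(* Laguerre's inequality at 0 for the j-th derivative of p *)
Lemma newton_coef p j : real_rooted p -> p \is a polyOver Num.real ->
  p`_j * p`_j.+2 <= p`_j.+1 ^+ 2.
Proof.
move=> hp pR.
have cR i : p`_i \is Num.real by rewrite (polyOverP pR).
have [r0|/ltW r0] := real_leP (rpredM (cR j) (cR j.+2)) (@real0 C).
  by apply: le_trans r0 _; rewrite -real_normK// exprn_ge0.
(* The zero polynomial has every z as a root and is not real-rooted, so a vanishing derivative is
   set apart. *)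
have [pj|pj] := eqVneq p^`(j) 0.
  have -> : p`_j = 0.
    move: pj => /(congr1 (fun q : {poly C} => q`_0)); rewrite coef_derivn addn0 coef0 => /eqP.
    by rewrite mulrn_eq0 ffactnn -leqn0 leqNgt fact_gt0 /= => /eqP.
  by rewrite mul0r -real_normK ?exprn_ge0.
have pjR : p^`(j) \is a polyOver Num.real by apply: polyOver_derivn.
have := laguerre (real_rooted_derivn pj hp) pjR (@real0 C).
rewrite -!derivnS !horner_coef0 !coef_derivn !addn0 !ffactnn.
have f0 : (0 : C) < (j`! * j.+1`!)%:R by rewrite ltr0n muln_gt0 !fact_gt0.
rewrite -(mulr_natr p`_j) -(mulr_natr p`_j.+1) -(mulr_natr p`_j.+2) exprMn => h.
rewrite -(ler_pM2l f0) -(ler_pM2l (ltr0Sn C j)).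
move: h; rewrite !factS !natrM.
set a := p`_j in r0 *; set b := p`_j.+2 in r0 *; set c := p`_j.+1; set f : C := j`!%:R => h.
(* Up to common factorials, [h] is the sharper (j+2) a b <= (j+1) c^2. Weakening j+2 to j+1 uses a b
   >= 0, which is why the other sign was disposed of first. *)
apply: le_trans (_ : j.+2%:R * ((f * (j.+1%:R * f)) * (a * b)) <= _).
  have f1 : 0 <= f by rewrite ler0n.
  apply: ler_wpM2r; last by rewrite ler_nat.
  by apply: mulr_ge0 => //; rewrite !mulr_ge0 ?ler0n.
apply: le_trans (le_trans (_ : _ <= a * f * (b * (j.+2%:R * (j.+1%:R * f)))) h) _.
  by rewrite le_eqVlt; apply/orP; left; apply/eqP; ring.
by rewrite le_eqVlt; apply/orP; left; apply/eqP; ring.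
Qed.

End RealRooted.

Lemma coef_linear_mul (R : comNzRingType) (a : R) (q : {poly R}) k :
  ((1 + a *: 'X) * q)`_k.+1 = q`_k.+1 + a * q`_k.
Proof. by rewrite mulrDl mul1r -scalerAl coefD coefZ coefXM. Qed.

(* If the first m elementary symmetric functions of (a, b_1, ..., b_n) are
   positive, then so are the first m - 1 of (b_1, ..., b_n). *)
Lemma pos_coef_cofactor (C : numClosedFieldType) (a : C) (q : {poly C}) m :
  a \is Num.real -> real_rooted q -> q \is a polyOver Num.real -> q`_0 = 1 ->
  (forall k, (0 < k <= m)%N -> 0 < ((1 + a *: 'X) * q)`_k) ->
  forall k, (k < m)%N -> 0 < q`_k.
Proof.
move=> aR qr qR q0 T; elim=> [|k IH] km; first by rewrite q0 ltr01.
have qk0 := IH (ltnW km).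
have := T k.+1 (ltnW km); rewrite coef_linear_mul => T1.
have := T k.+2 km; rewrite coef_linear_mul => T2.
have cR i : q`_i \is Num.real by rewrite (polyOverP qR).
have [q1|//] := real_leP (cR k.+1) (@real0 C).
have b0 : 0 <= - q`_k.+1 by rewrite oppr_ge0.
have T1' : - q`_k.+1 < a * q`_k by rewrite -subr_gt0 opprK addrC.
have T2' : a * - q`_k.+1 < q`_k.+2 by rewrite -subr_gt0 mulrN opprK.
(* With b = - q_(k+1) >= 0, Newton closes a cycle: q_k a b < q_k q_(k+2) <= b^2 <= (a q_k) b. *)
suff : q`_k * (a * - q`_k.+1) < q`_k * (a * - q`_k.+1) by rewrite ltxx.
apply: (@lt_le_trans _ _ (q`_k * q`_k.+2)); first by rewrite ltr_pM2l.
apply: le_trans (newton_coef k qr qR) _.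
rewrite -sqrrN expr2 mulrA [q`_k * a]mulrC.
by rewrite ler_wpM2r// ltW.
Qed.

(** * Determinants of rank-one perturbations of a diagonal matrix *)

Lemma det_diag_rank1 (F : fieldType) n (d : 'rV[F]_n) (u : 'cV[F]_n) (v : 'rV[F]_n) :
  (forall i, d 0 i != 0) ->
  \det (diag_mx d + u *m v) = \prod_i d 0 i * (1 + \sum_i u i 0 * v 0 i / d 0 i).
Proof.
move=> d0; pose Di : 'M[F]_n := diag_mx (\row_i (d 0 i)^-1).
have DiD : Di *m diag_mx d = 1%:M.
  apply/matrixP => i j; rewrite mul_diag_mx !mxE.
  by case: eqVneq => [->|_]; rewrite /= ?mulr0n ?mulr0// !mulr1n mulVf.
(* Compare two block factorizations of [[1, v], [-u, diag d]]. *)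
have e1 : block_mx 1%:M v (- u) (diag_mx d) =
  block_mx 1%:M 0 (- u) 1%:M *m block_mx 1%:M v 0 (diag_mx d + u *m v).
  rewrite mulmx_block !mul1mx !mulmx1 ?mul0mx ?mulmx0 !addr0 mulNmx.
  by congr block_mx; rewrite addrC addrK.
have e2 : block_mx 1%:M v (- u) (diag_mx d) =
  block_mx (1%:M + v *m Di *m u) (v *m Di) 0 1%:M *m block_mx 1%:M 0 (- u) (diag_mx d).
  rewrite mulmx_block !mul1mx !mulmx1 ?mul0mx ?mulmx0 !add0r.
  by rewrite mulmxN addrK -mulmxA DiD mulmx1.
have := congr1 determinant e1; rewrite e2 !det_mulmx !det_ublock !det_lblock !det1 !mul1r !mulr1.
rewrite det_diag => <-; rewrite mulrC; congr (_ * _).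
rewrite [_ + _]mx11_scalar det_scalar expr1 !mxE eqxx; congr (_ + _).
apply: eq_bigr => i _; rewrite mul_mx_diag !mxE; ring.
Qed.

(** The matrix determinant lemma with denominators cleared, obtained in the fraction field. It will
    be applied to the diagonal entries 1 + d_i X, which are nonzero but not invertible
    polynomials. *)
Lemma det_diag_rank1_idomain (R : idomainType) n (d : 'rV[R]_n) (u : 'cV[R]_n) (v : 'rV[R]_n) :
  (forall i, d 0 i != 0) ->
  \det (diag_mx d + u *m v) =
  \prod_i d 0 i + \sum_i u i 0 * v 0 i * \prod_(j | j != i) d 0 j.
Proof.
move=> d0; apply/eqP; rewrite -tofrac_eq; apply/eqP.
have d0' i : (map_mx (@tofrac R) d) 0 i != 0 by rewrite mxE tofrac_eq0.
rewrite -det_map_mx map_mxD map_mxM /= map_diag_mx (det_diag_rank1 _ _ d0').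
rewrite rmorphD /= rmorph_prod rmorph_sum mulrDr mulr1 mulr_sumr; congr (_ + _).
  by apply: eq_bigr => i _; rewrite mxE.
apply: eq_bigr => i _; rewrite (bigD1 i)//= !rmorphM /= rmorph_prod !mxE.
under eq_bigr do rewrite mxE.
by field; rewrite tofrac_eq0.
Qed.

(* The coefficient of 'X^k is the sum of the principal k x k minors of A. *)
Definition minors_poly (R : comNzRingType) n (A : 'M[R]_n) : {poly R} :=
  \det (1%:M + 'X *: map_mx polyC A).

Lemma minors_poly_conj (F : fieldType) n (P A : 'M[F]_n) : P \in unitmx ->
  minors_poly (invmx P *m A *m P) = minors_poly A.
Proof.
move=> Pu; rewrite /minors_poly !map_mxM /=.
set iP := map_mx polyC (invmx P); set P' := map_mx polyC P.
have iPP : iP *m P' = 1%:M by rewrite -map_mxM /= mulVmx// map_mx1.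
have -> : 1%:M + 'X *: (iP *m map_mx polyC A *m P') =
   iP *m (1%:M + 'X *: map_mx polyC A) *m P'.
  by rewrite mulmxDr mulmxDl mulmx1 iPP -scalemxAr -scalemxAl.
rewrite !det_mulmx mulrAC [_ * \det P']mulrC -det_mulmx.
by rewrite (mulmx1C iPP) det1 mul1r.
Qed.

Lemma minors_poly_diag_rank1 (R : idomainType) n (d : 'rV[R]_n) (u : 'cV_n) (v : 'rV_n) :
  minors_poly (diag_mx d + u *m v) =
  \prod_i (1 + d 0 i *: 'X) +
  'X * \sum_i (u i 0 * v 0 i) *: \prod_(j | j != i) (1 + d 0 j *: 'X).
Proof.
pose d' := \row_i (1 + d 0 i *: 'X) : 'rV[{poly R}]_n.
have d'0 i : d' 0 i != 0.
  apply/eqP => /(congr1 (fun q : {poly R} => q`_0)); rewrite mxE coefD coef1 coefZ coefX mulr0.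
  by rewrite addr0 coef0; apply/eqP/oner_neq0.
have -> : minors_poly (diag_mx d + u *m v) =
    \det (diag_mx d' + ('X *: map_mx polyC u) *m map_mx polyC v).
  rewrite /minors_poly; congr (\det _); rewrite map_mxD map_mxM /= scalerDr addrA scalemxAl.
  congr (_ + _); apply/matrixP => i j; rewrite !mxE.
  by case: eqVneq => [->|_]; rewrite ?mulr0n ?mulr1n ?mulr0 ?addr0// mulrC mul_polyC.
rewrite (det_diag_rank1_idomain _ _ d'0); congr (_ + _).
  by apply: eq_bigr => i _; rewrite mxE.
rewrite mulr_sumr; apply: eq_bigr => i _; rewrite !mxE.
under eq_bigr do rewrite mxE.
by rewrite -mul_polyC polyCM !mulrA.
Qed.

(** * Hermitian matrices: spectral decomposition and monotonicity of the minors *)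

Section Hermitian.
Variable C : numClosedFieldType.

Lemma hermitianE n (A : 'M[C]_n) : (A \is hermsymmx) = (A == A^t*).
Proof. by rewrite is_hermitianmxE expr0 scale1r. Qed.

Lemma hermitian_spectral n (A : 'M[C]_n) : A \is hermsymmx ->
  exists P d, [/\ P \is unitarymx, d \is a realmx & A = invmx P *m diag_mx d *m P].
Proof.
move=> Ah; exists (spectralmx A), (spectral_diag A).
by rewrite spectral_unitarymx hermitian_spectral_diag_real// -(orthomx_spectralP (hermitian_normalmx Ah)).
Qed.

Lemma prod_linear_real (I : Type) (r : seq I) (P : pred I) (d : I -> C) :
  (forall i, d i \is Num.real) ->
  let q := \prod_(i <- r | P i) (1 + d i *: 'X) in
  [/\ real_rooted q, q \is a polyOver Num.real & q`_0 = 1].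
Proof.
move=> dR /=; apply: (big_ind (fun q : {poly C} => [/\ real_rooted q, q \is a polyOver Num.real & q`_0 = 1])).
- by split=> [z||]; [rewrite (negPf (root1 z)) | apply/polyOverP => i; rewrite coef1 realn | rewrite coef1].
- move=> p q [p1 p2 p3] [q1 q2 q3]; split; last by rewrite coef0M p3 q3 mulr1.
    by move=> z; rewrite rootM => /orP[/p1|/q1].
  apply/polyOverP => k; rewrite coefM rpred_sum// => j _.
  by rewrite rpredM ?(polyOverP p2) ?(polyOverP q2).
- move=> i _; split.
  + move=> z; rewrite rootE !hornerE addrC addr_eq0 => /eqP dz.
    have d0 : d i != 0.
      by apply: contra_eq_neq dz => ->; rewrite mul0r eq_sym oppr_eq0 oner_neq0.
    have -> : z = - (d i)^-1 by apply: (mulfI d0); rewrite dz mulrN divff.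
    by rewrite rpredN rpredV.
  + by apply/polyOverP => k; rewrite coefD coef1 coefZ coefX rpredD ?realn// rpredM ?realn.
  + by rewrite coefD coef1 coefZ coefX mulr0 addr0.
Qed.

Lemma minors_poly_diag n (d : 'rV[C]_n) : minors_poly (diag_mx d) = \prod_i (1 + d 0 i *: 'X).
Proof.
have := minors_poly_diag_rank1 d 0 0; rewrite mulmx0 addr0 => ->.
by rewrite [X in _ * X]big1 ?mulr0 ?addr0// => i _; rewrite mxE mul0r scale0r.
Qed.

Lemma hermitian_minors_poly n (A : 'M[C]_n) : A \is hermsymmx ->
  let q := minors_poly A in
  [/\ real_rooted q, q \is a polyOver Num.real & q`_0 = 1].
Proof.
move=> /hermitian_spectral[P [d [Pu /mxOverP dR ->]]] /=.
rewrite minors_poly_conj ?unitarymx_unit// minors_poly_diag.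
exact: prod_linear_real.
Qed.

(** In a basis diagonalizing A, coefficient k grows by the sum over i of |(P v)_i|^2 times
    coefficient k-1 of the product without its i-th factor, which is positive by
    [pos_coef_cofactor]. *)
Lemma rank1_minors_le n (A : 'M[C]_n) (v : 'cV[C]_n) m : A \is hermsymmx ->
  (forall k, (0 < k <= m)%N -> 0 < (minors_poly A)`_k) ->
  forall k, (k <= m)%N -> (minors_poly A)`_k <= (minors_poly (A + v *m v^t*))`_k.
Proof.
move=> /hermitian_spectral[P [d [Pu /mxOverP dR AE]]] Apos k km.
have Pun := unitarymx_unit Pu.
have -> : A + v *m v^t* = invmx P *m (diag_mx d + (P *m v) *m (P *m v)^t*) *m P.
  rewrite mulmxDr mulmxDl -AE trmx_mul map_mxM /= -(invmx_unitary Pu).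
  by rewrite !mulmxA mulVmx// mul1mx -mulmxA mulVmx// mulmx1.
rewrite minors_poly_conj// minors_poly_diag_rank1.
move: Apos; rewrite {1}AE minors_poly_conj// minors_poly_diag AE minors_poly_conj// minors_poly_diag => Apos.
rewrite coefD coefXM; case: k km => [|k] km /=; first by rewrite addr0.
rewrite lerDl coef_sum sumr_ge0// => i _; rewrite coefZ.
rewrite mulr_ge0// ?mxE ?mul_conjC_ge0//.
have [q1 q2 q3] := prod_linear_real (index_enum 'I_n) (fun j => j != i) (fun j => dR 0 j).
apply/ltW/(pos_coef_cofactor (dR 0 i) q1 q2 q3) => [l lm|]; last exact: km.
by have := Apos l lm; rewrite (bigD1 i).
Qed.

Definition psdmx n (P : 'M[C]_n) := forall v : 'cV_n, 0 <= (v^t* *m P *m v) 0 0.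

Lemma psd_sum_rank1 n (P : 'M[C]_n) : P \is hermsymmx -> psdmx P ->
  exists w : 'I_n -> 'cV_n, P = \sum_i w i *m (w i)^t*.
Proof.
move=> /hermitian_spectral[U [d [Uu /mxOverP dR PE]]] Pp.
have Uun := unitarymx_unit Uu.
have d0 i : 0 <= d 0 i.
  (* Testing the form on the i-th eigenvector returns the i-th eigenvalue. *)
  have := Pp ((row i U)^t*); rewrite trmxCK PE (invmx_unitary Uu).
  have e : row i U *m U^t* = delta_mx 0 i.
    by rewrite -row_mul (unitarymxP Uu) row1.
  have e' : U *m (row i U)^t* = delta_mx i 0.
    have := congr1 (fun M : 'rV_n => M^t*) e.
    by rewrite trmx_mul map_mxM /= trmxCK trmx_delta map_delta_mx.
  rewrite !mulmxA e -[_ *m U *m _]mulmxA e' mul_mx_diag mxE (bigD1 i)//= big1 => [|j ji].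
    by rewrite !mxE !eqxx mulr1 mul1r addr0.
  by rewrite !mxE (negPf ji) mulr0.
exists (fun i => sqrtC (d 0 i) *: (row i U)^t*).
rewrite PE (invmx_unitary Uu); apply/matrixP => a b; rewrite mxE summxE.
apply: eq_bigr => i _; rewrite mul_mx_diag !mxE big_ord1 !mxE.
have sR : (sqrtC (d 0 i))^* = sqrtC (d 0 i) by apply/conj_Creal/ger0_real; rewrite sqrtC_ge0.
by rewrite rmorphM /= conjCK sR -{1}[d 0 i]sqrtCK; ring.
Qed.

Lemma psd_minors_le n (A B : 'M[C]_n) m : A \is hermsymmx -> B \is hermsymmx ->
  psdmx (B - A) ->
  (forall k, (0 < k <= m)%N -> 0 < (minors_poly A)`_k) ->
  (minors_poly A)`_m <= (minors_poly B)`_m.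
Proof.
move=> Ah Bh BA Apos.
have BAh : B - A \is hermsymmx.
  move: Ah Bh; rewrite !hermitianE => /eqP Ah /eqP Bh.
  by rewrite linearB /= map_mxB -Ah -Bh.
have [w wE] := psd_sum_rank1 BAh BA.
(* All k <= m are compared at once, not only k = m: this keeps every partial sum in the cone, as the
   next rank-one step requires. *)
suff : forall s : seq 'I_n, A + \sum_(i <- s) w i *m (w i)^t* \is hermsymmx /\
   forall k, (k <= m)%N -> (minors_poly A)`_k <= (minors_poly (A + \sum_(i <- s) w i *m (w i)^t*))`_k.
  by move=> /(_ (index_enum _)) [_ /(_ m (leqnn m))]; rewrite -wE addrC subrK.
elim=> [|i s [IH1 IH2]]; first by rewrite big_nil addr0.
rewrite big_cons [X in A + X]addrC addrA; split.
  move: IH1; rewrite !hermitianE; set S := A + _ => /eqP SE.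
  by rewrite linearD /= map_mxD -SE trmx_mul map_mxM /= trmxCK.
move=> k km; apply: le_trans (IH2 k km) _; apply: rank1_minors_le (km) => // l /andP[l0 lm].
by apply: lt_le_trans (IH2 l lm); apply: Apos; rewrite l0.
Qed.
End Hermitian.

(** * The elementary functions [Tp] of a real symmetric matrix *)

Lemma RsumE (l : seq R) : Rsum l = \sum_(x <- l) x.
Proof. by elim: l => [|x l IH]; rewrite ?big_nil// big_cons /= IH. Qed.

Lemma nth_rem_nth (T : Type) (x0 : T) (j : nat) (s : seq T) k :
  nth x0 (rem_nth j s) k = nth x0 s (bump j k).
Proof.
elim: s j k => [|x s IH] [|j] [|k] //=; rewrite ?nth_nil//.
by rewrite IH /bump ltnS; case: (j <= k)%N.
Qed.

Lemma size_rem_nth (T : Type) j (s : seq T) : (j < size s)%N -> size (rem_nth j s) = (size s).-1.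
Proof. by elim: s j => [|x s IH] [|j] //= js; rewrite IH//; case: s js {IH}. Qed.

Lemma detL_cons n (A : 'I_n -> 'I_n -> R) r rs c cs :
  detL A (r :: rs) (c :: cs) = \sum_(k < size (c :: cs))
    (-1) ^+ odd k * A r (nth c (c :: cs) k) * detL A rs (rem_nth k (c :: cs)).
Proof.
rewrite -(big_mkord xpredT (fun k => (-1) ^+ odd k * A r (nth c (c :: cs) k) *
   detL A rs (rem_nth k (c :: cs)))) /index_iota subn0.
rewrite -(big_map _ xpredT id) -RsumE; congr (Rsum _); apply: eq_map => k.
by rewrite !RmultE; congr (_ * _ * _); case: (odd k); rewrite ?expr1 ?expr0//.
Qed.

Lemma detLE n (A : 'I_n -> 'I_n -> R) x0 N rows cols : size rows = N -> size cols = N ->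
  detL A rows cols = \det (\matrix_(i < N, j < N) A (nth x0 rows i) (nth x0 cols j)).
Proof.
elim: N rows cols => [|N IH] [|r rs] [|c cs] //; first by rewrite det_mx00.
move=> [sr] [sc]; rewrite (expand_det_row _ ord0) detL_cons /= sc.
apply: eq_bigr => j _; rewrite (IH _ (rem_nth j (c :: cs)))//; last by rewrite size_rem_nth /= sc.
rewrite /cofactor mxE /= add0n (set_nth_default x0) /= ?sc//.
rewrite signr_odd -mulrA mulrCA; congr (_ * (_ * \det _)).
by apply/matrixP => a b; rewrite !mxE nth_rem_nth.
Qed.

(* The 1s of [1 + X B] are kept only from position k on: expanding along row k
   then matches the recursion of [subsets]. *)
Definition tail_minors_poly (N k : nat) (B : nat -> nat -> R) : {poly R} :=
  \det (\matrix_(i < N, j < N) (((k <= i)%N && (i == j))%:R + 'X * (B i j)%:P)).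

(** The matrices behind the two sides differ only by a 1 in entry (k, k), and the determinant is
    affine in that entry. The first summand keeps index k in the minor; the second deletes row and
    column k. *)
Lemma tail_minors_polyS N k B : (k <= N)%N ->
  tail_minors_poly N.+1 k B =
  tail_minors_poly N.+1 k.+1 B + tail_minors_poly N k (fun i j => B (bump k i) (bump k j)).
Proof.
move=> kN; pose kk : 'I_N.+1 := Ordinal (kN : (k < N.+1)%N).
rewrite /tail_minors_poly; set M := \matrix_(i, j) _; set M' := \matrix_(i, j) _.
have cE j : cofactor M kk j = cofactor M' kk j.
  rewrite /cofactor; congr (_ * \det _); apply/matrixP => a b; rewrite !mxE.
  congr (_%:R + _); congr andb; rewrite [in RHS]ltn_neqAle.
  by rewrite -[k]/(val kk) (inj_eq val_inj) neq_lift.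
rewrite (expand_det_row M kk) (expand_det_row M' kk).
have -> : \sum_j M kk j * cofactor M kk j =
    \sum_j (M' kk j * cofactor M' kk j + (kk == j)%:R * cofactor M kk j).
  apply: eq_bigr => j _; rewrite cE -mulrDl; congr (_ * _); rewrite !mxE /=.
  by rewrite leqnn ltnn /= add0r addrC.
rewrite big_split /=; congr (_ + _).
rewrite (bigD1 kk)//= big1 ?addr0 => [|j jk]; last by rewrite eq_sym (negPf jk) mul0r.
rewrite eqxx mul1r /cofactor -signr_odd addnn odd_double mul1r.
congr (\det _); apply/matrixP => i j; rewrite !mxE.
congr (_%:R + _); rewrite (inj_eq lift_inj) /= /bump; congr andb.
by case: (leqP k i) => //= h; rewrite ?add1n ?add0n ?leqW// leqNgt h.
Qed.

Lemma nth_cat_bump (T : Type) (x0 : T) L c s i :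
  nth x0 (L ++ c :: s) (bump (size L) i) = nth x0 (L ++ s) i.
Proof. by elim: L i => [|x L IH] [|i] //=; rewrite -IH /bump ltnS addnS. Qed.

(** [L] lists the indices already chosen and [s] the undecided ones, so the coefficient collects the
    minors of size q that contain [L]. When [s] is empty the matrix is X times a scalar matrix, and
    only the power X^(size L) remains. *)
Lemma coef_tail_minors_poly n (A : 'I_n -> 'I_n -> R) x0 L s q :
  let l := L ++ s in
  (tail_minors_poly (size l) (size L) (fun i j => A (nth x0 l i) (nth x0 l j)))`_q =
  if (size L <= q)%N then Rsum [seq detL A (L ++ J) (L ++ J) | J <- subsets s (q - size L)]
  else 0.
Proof.
elim: s L q => [|c s IH] L q /=.
  rewrite cats0 /tail_minors_poly.
  have -> : \matrix_(i < size L, j < size L) (((size L <= i)%N && (i == j))%:R +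
      'X * (A (nth x0 L i) (nth x0 L j))%:P) =
      'X *: map_mx polyC (\matrix_(i < size L, j < size L) A (nth x0 L i) (nth x0 L j)).
    by apply/matrixP => i j; rewrite !mxE leqNgt ltn_ord /= add0r.
  rewrite detZ det_map_mx -(detLE A x0 erefl erefl) coefXnM.
  case: ltngtP => [qL|qL|->]; last 1 first.
  - by rewrite subnn coefC eqxx /= cats0 Rplus_0_r.
  - by [].
  - by rewrite -(subnSK qL) /= coefC.
rewrite size_cat /= addnS tail_minors_polyS ?leq_addr// coefD.
have := IH (rcons L c) q; rewrite /= cat_rcons size_cat size_rcons /= addnS => ->.
have -> : tail_minors_poly (size L + size s) (size L)
     (fun i j => A (nth x0 (L ++ c :: s) (bump (size L) i)) (nth x0 (L ++ c :: s) (bump (size L) j)))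
   = tail_minors_poly (size (L ++ s)) (size L) (fun i j => A (nth x0 (L ++ s) i) (nth x0 (L ++ s) j)).
  rewrite size_cat; congr (\det _); apply/matrixP => i j; rewrite !mxE; congr (_ + 'X * (A _ _)%:P).
    exact: nth_cat_bump.
  exact: nth_cat_bump.
rewrite IH.
have [Lq|Lq] := leqP (size L) q; last by rewrite ltnNge (ltnW Lq) addr0.
have [Lq'|Lq'] := ltnP (size L) q; last first.
  have -> : (q - size L = 0)%N by apply/eqP; rewrite subn_eq0.
  by rewrite add0r; case: s {IH}.
rewrite -(subnSK Lq').
rewrite !RsumE map_cat big_cat /= -!map_comp; congr (_ + _).
by under eq_map do rewrite cat_rcons.
Qed.

Lemma Tp_minors_poly n p (A : 'I_n -> 'I_n -> R) :
  Tp p A = (minors_poly (\matrix_(i, j) A i j))`_p.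
Proof.
case: n A => [|n] A.
  rewrite /minors_poly det_mx00 /Tp (size0nil (size_enum_ord 0)) coef1.
  by case: p => //=; rewrite Rplus_0_r.
have := @coef_tail_minors_poly n.+1 A ord0 [::] (enum 'I_n.+1) p.
rewrite /= subn0 /Tp => <-; rewrite size_enum_ord; congr ((polyseq (\det _))`_p).
by apply/matrixP => i j; rewrite !mxE /= !nth_ord_enum.
Qed.

Local Notation toC := (real_complex R).

Lemma map_minors_poly n (A : 'M[R]_n) :
  map_poly toC (minors_poly A) = minors_poly (map_mx toC A).
Proof.
rewrite /minors_poly -det_map_mx; congr (\det _); apply/matrixP => i j.
by rewrite !mxE rmorphD rmorphM /= map_polyX map_polyC rmorph_nat.
Qed.

(** Real symmetric matrices become hermitian over R[i], where the spectral argument runs;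
    inequalities return to R because the embedding preserves and reflects the order. *)
Definition cmx n (A : 'I_n -> 'I_n -> R) : 'M[R[i]]_n := \matrix_(i, j) toC (A i j).

Lemma Tp_cmx n p (A : 'I_n -> 'I_n -> R) : toC (Tp p A) = (minors_poly (cmx A))`_p.
Proof.
rewrite Tp_minors_poly -coef_map map_minors_poly; congr ((polyseq (minors_poly _))`_p).
by apply/matrixP => i j; rewrite !mxE.
Qed.

Lemma cmx_hermitian n (A : 'I_n -> 'I_n -> R) : (forall i j, A i j = A j i) ->
  cmx A \is hermsymmx.
Proof.
move=> As; rewrite hermitianE; apply/eqP/matrixP => i j; rewrite !mxE /= As.
by rewrite conj_Creal// complex_real.
Qed.

Theorem Tp_newton n k (A : 'I_n -> 'I_n -> R) : (forall i j, A i j = A j i) ->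
  (Tp k A * Tp k.+2 A <= Tp k.+1 A ^ 2)%coqR.
Proof.
move=> /cmx_hermitian/hermitian_minors_poly[h1 h2 _].
apply/RleP; rewrite RpowE RmultE -lecR rmorphM rmorphXn /= !Tp_cmx.
exact: newton_coef.
Qed.

Definition quad n (A : 'I_n -> 'I_n -> R) (xi : 'I_n -> R) : R :=
  \sum_i \sum_j xi i * A i j * xi j.

Theorem Tp_mono n m (A B : 'I_n -> 'I_n -> R) :
  (forall i j, A i j = A j i) -> (forall i j, B i j = B j i) ->
  (forall xi, (0 <= quad (fun i j => B i j - A i j) xi)%coqR) ->
  Km m A -> (Tp m A <= Tp m B)%coqR.
Proof.
move=> As Bs BA Am; apply/RleP; rewrite -lecR !Tp_cmx.
apply: psd_minors_le; [exact: cmx_hermitian | exact: cmx_hermitian | move=> v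
  | move=> k /andP[k0 km]]; last first.
  by rewrite -Tp_cmx ltcR; apply/RltP/Am.
pose P := cmx (fun i j => B i j - A i j).
have -> : cmx B - cmx A = P by apply/matrixP => i j; rewrite !mxE rmorphB.
pose x : 'cV[R[i]]_n := \col_i toC (complex.Re (v i 0)).
pose y : 'cV[R[i]]_n := \col_i toC (complex.Im (v i 0)).
have vE : v = x + 'i *: y by apply/colP => i; rewrite !mxE -complexiE -complexE.
have vcE : v^t* = x^T - 'i *: y^T.
  rewrite vE; apply/rowP => i; rewrite !mxE rmorphD rmorphM /= conjCi.
  by rewrite !conj_Creal ?complex_real// mulNr.
have xyE : (x^T *m P *m y) 0 0 = (y^T *m P *m x) 0 0.
  have -> : x^T *m P *m y = (y^T *m P *m x)^T; last by rewrite mxE.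
  rewrite !trmx_mul trmxK mulmxA; congr (_ *m _ *m _).
  by apply/matrixP => i j; rewrite !mxE As Bs.
have qE (z : 'I_n -> R) (w := \col_i toC (z i)) : 
    (w^T *m P *m w) 0 0 = toC (quad (fun i j => B i j - A i j) z).
  rewrite mxE /quad exchange_big rmorph_sum /=; apply: eq_bigr => j _.
  rewrite mxE rmorph_sum mulr_suml; apply: eq_bigr => i _ /=.
  by rewrite !mxE !rmorphM.
(* The real form is assumed nonnegative on real vectors only. For v = x + i y the cross terms cancel
   by symmetry ([xyE]), leaving its values at x and at y. *)
rewrite vcE vE; have -> : ((x^T - 'i *: y^T) *m P *m (x + 'i *: y)) 0 0 =
   (x^T *m P *m x) 0 0 + (y^T *m P *m y) 0 0.
  rewrite !mulmxDl !mulmxDr !mulNmx -!scalemxAl -!scalemxAr !scalerA.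
  rewrite -expr2 sqrCi scaleN1r opprK.
  move: xyE; set a := x^T *m P *m x; set b := x^T *m P *m y; set c := y^T *m P *m x.
  by rewrite !mxE => ->; ring.
rewrite !qE -rmorphD /= -(rmorph0 toC) lecR; apply: addr_ge0; exact/RleP.
Qed.

End Minors.

(** * Bordered matrices diag(s, A), homogeneity and monotonicity of their minors *)

Section Bord.
Import Order.TTheory GRing.Theory Num.Theory.
Local Open Scope ring_scope.

(* diag(s, A) *)
Definition bord n (s : R) (A : 'I_n -> 'I_n -> R) (i j : 'I_n.+1) : R :=
  match unlift ord0 i, unlift ord0 j with
  | Some i', Some j' => A i' j'
  | None, None => s
  | _, _ => 0
  end.

Lemma subsets_map (T T' : Type) (f : T -> T') s p :
  subsets (map f s) p = map (map f) (subsets s p).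
Proof.
elim: s p => [|x s IH] [|p] //=.
by rewrite !IH map_cat -!map_comp.
Qed.

Lemma rem_nth_map (T T' : Type) (f : T -> T') k s : rem_nth k (map f s) = map f (rem_nth k s).
Proof. by elim: s k => [|x s IH] [|k] //=; rewrite IH. Qed.

Lemma bord_lift n s (A : 'I_n -> 'I_n -> R) i j : bord s A (lift ord0 i) (lift ord0 j) = A i j.
Proof. by rewrite /bord !liftK. Qed.

Lemma detL_bord_lift n s (A : 'I_n -> 'I_n -> R) rows cols :
  detL (bord s A) (map (lift ord0) rows) (map (lift ord0) cols) = detL A rows cols.
Proof.
elim: rows cols => [|r rs IH] [|c cs] //.
rewrite [map _ (r :: rs)]/= [map _ (c :: cs)]/= !detL_cons /= size_map.
apply: eq_bigr => k _.
rewrite -[lift ord0 c :: _]/(map (lift ord0) (c :: cs)) rem_nth_map IH.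
by rewrite (nth_map c) ?size_map// bord_lift.
Qed.

Lemma detL_bord0 n s (A : 'I_n -> 'I_n -> R) J :
  detL (bord s A) (ord0 :: map (lift ord0) J) (ord0 :: map (lift ord0) J) = s * detL A J J.
Proof.
rewrite detL_cons /= big_ord_recl /= expr0 mul1r detL_bord_lift big1 ?addr0.
  by rewrite /bord unlift_none.
move=> k _; have /mapP[j _] := mem_nth ord0 (ltn_ord k); rewrite /= => ->.
by rewrite /bord unlift_none liftK mulr0 mul0r.
Qed.

Lemma Tp0 n (A : 'I_n -> 'I_n -> R) : Tp 0 A = 1%coqR.
Proof. by rewrite /Tp; case: (enum _) => [|? ?] /=; rewrite Rplus_0_r. Qed.

Lemma Tp_bord n k s (A : 'I_n -> 'I_n -> R) :
  Tp k.+1 (bord s A) = (s * Tp k A + Tp k.+1 A)%coqR.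
Proof.
rewrite RplusE RmultE.
rewrite /Tp enum_ordSl [subsets (_ :: _) _]/= map_cat !RsumE big_cat !subsets_map.
rewrite !big_map mulr_sumr; congr (_ + _); apply: eq_bigr => J _; first exact: detL_bord0.
exact: detL_bord_lift.
Qed.

Lemma bord_sym n s (A : 'I_n -> 'I_n -> R) : (forall i j, A i j = A j i) ->
  forall i j, bord s A i j = bord s A j i.
Proof. by move=> As i j; rewrite /bord; case: (unlift ord0 i); case: (unlift ord0 j). Qed.

Lemma quad_bord n s r (A B : 'I_n -> 'I_n -> R) (xi : 'I_n.+1 -> R) :
  quad (fun i j => bord r B i j - bord s A i j) xi =
  ((r - s) * xi ord0 ^ 2 + quad (fun i j => B i j - A i j) (fun i => xi (lift ord0 i)))%coqR.
Proof.
rewrite RplusE RmultE RpowE.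
rewrite /quad big_ord_recl big_ord_recl big1 ?addr0 => [|j _]; last first.
  by rewrite /bord unlift_none liftK subrr mulr0 mul0r.
congr (_ + _); first by rewrite /bord unlift_none expr2 mulrAC mulrC mulrA.
apply: eq_bigr => i _; rewrite big_ord_recl {1 2}/bord unlift_none liftK subrr mulr0 mul0r add0r.
by apply: eq_bigr => j _; rewrite !bord_lift.
Qed.

Lemma quadN n (A B : 'I_n -> 'I_n -> R) xi : (forall i j, B i j = (- A i j)%coqR) ->
  quad B xi = (- quad A xi)%coqR.
Proof.
move=> BA; rewrite RoppE /quad -sumrN; apply: eq_bigr => i _; rewrite -sumrN.
by apply: eq_bigr => j _; rewrite BA RoppE mulrN mulNr.
Qed.

Lemma Tp_bord_mono n m s r (A B : 'I_n -> 'I_n -> R) :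
  (forall i j, A i j = A j i) -> (forall i j, B i j = B j i) ->
  (s <= r)%coqR -> (forall xi, (0 <= quad (fun i j => B i j - A i j) xi)%coqR) ->
  Km m (bord s A) -> (Tp m (bord s A) <= Tp m (bord r B))%coqR.
Proof.
move=> As Bs sr BA; apply: Tp_mono; [exact: bord_sym | exact: bord_sym | move=> xi].
rewrite quad_bord; apply: Rplus_le_le_0_compat; last exact: BA.
apply: Rmult_le_pos; last exact: pow2_ge_0.
by apply/RleP; rewrite subr_ge0; apply/RleP.
Qed.

Lemma size_subsets (T : eqType) (s : seq T) p J : J \in subsets s p -> size J = p.
Proof.
elim: s p J => [|x s IH] [|p] J //=; rewrite ?inE; try by move=> /eqP->.
by rewrite mem_cat => /orP[/mapP[J' /IH <- ->]|/IH].
Qed.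

Lemma detL_scale n a (A : 'I_n -> 'I_n -> R) rows cols :
  detL (fun i j => a * A i j) rows cols = a ^+ size rows * detL A rows cols.
Proof.
elim: rows cols => [|r rs IH] [|c cs]; [by rewrite mul1r | by rewrite mul1r | by rewrite mulr0 |].
rewrite !detL_cons mulr_sumr; apply: eq_bigr => k _.
by rewrite IH exprS [_ * (a * _)]mulrCA mulrACA.
Qed.

Lemma Tp_scale n p a (A : 'I_n -> 'I_n -> R) :
  Tp p (fun i j => a * A i j)%coqR = (a ^ p * Tp p A)%coqR.
Proof.
rewrite RmultE RpowE.
rewrite /Tp !RsumE !big_map mulr_sumr !big_seq; apply: eq_bigr => J /size_subsets <-.
exact: detL_scale.
Qed.
End Bord.

Local Open Scope R_scope.

(** * The cone of m-positive matrices *)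

Section Closure.
Variables (X : Type) (Q : (X -> R) -> Prop).
Hypothesis Qc : forall c, Q (fun=> c).
Hypothesis QD : forall f g, Q f -> Q g -> Q (fun x => f x + g x).
Hypothesis QM : forall f g, Q f -> Q g -> Q (fun x => f x * g x).

Lemma Rsum_closed (T : Type) (F : T -> X -> R) s :
  (forall k, Q (F k)) -> Q (fun x => Rsum [seq F k x | k <- s]).
Proof. by move=> HF; elim: s => [|k s IH] /=; [exact: Qc | exact: QD]. Qed.

(** [Tp] is a polynomial in the entries. The abstract class [Q] lets the recursion through the
    nested lists be walked without any estimate; it will be instantiated with joint continuity. *)
Lemma Tp_closed n p (A : X -> 'I_n -> 'I_n -> R) :
  (forall i j, Q (fun x => A x i j)) -> Q (fun x => Tp p (A x)).
Proof.
move=> HA; apply: (Rsum_closed (F := fun J x => detL (A x) J J)) => J.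
have: forall rows cols, Q (fun x => detL (A x) rows cols); last exact.
elim=> [|r rs IH] [|c cs] /=; try exact: Qc.
apply: QD; first by apply: QM; [apply: QM; [exact: Qc | exact: HA] | exact: IH].
apply: (Rsum_closed (F := fun k x =>
  (if odd k then -1 else 1) * A x r (nth c (c :: cs) k) * detL (A x) rs (rem_nth k (c :: cs)))) => k.
by apply: QM; [apply: QM; [exact: Qc | exact: HA] | exact: IH].
Qed.
End Closure.

(** Maclaurin's inequality T_(k+1)^(1/(k+1)) <= T_k^(1/k), without binomial weights and without
    roots. Newton raised to the power k+1, combined with the previous case, leaves a common factor
    T_(k+1)^k to cancel. *)
Lemma maclaurin_step (T : nat -> R) m : T 0%N = 1 ->
  (forall k, T k * T k.+2 <= T k.+1 ^ 2) ->
  (forall p, (1 <= p)%N -> (p <= m)%N -> 0 < T p) ->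
  forall k, (k < m)%N -> T k.+1 ^ k <= T k ^ k.+1.
Proof.
move=> T0 N P; elim=> [|k IH] km; first by rewrite T0 /=; lra.
have Tk1 : 0 < T k.+1 by apply: P => //; exact: ltnW.
have Tk2 : 0 < T k.+2 by apply: P.
have Tk : 0 < T k by case: k km {IH Tk1 Tk2} => [|k] km; [rewrite T0; lra | apply: P => //; exact/ltnW/ltnW].
have {}IH := IH (ltnW km).
have e1 : T k ^ k.+1 * T k.+2 ^ k.+1 <= T k.+1 ^ (2 * k.+1).
  rewrite -Rpow_mult_distr pow_mult; apply: pow_incr; split; last exact: N.
  by apply: Rmult_le_pos; lra.
apply: (Rmult_le_reg_l (T k.+1 ^ k)); first exact: pow_lt.
rewrite -pow_add; apply: Rle_trans (_ : _ <= T k ^ k.+1 * T k.+2 ^ k.+1) _.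
  by apply: Rmult_le_compat_r => //; apply/pow_le/Rlt_le.
by apply: Rle_trans e1 _; right; congr pow; rewrite plusE mul2n -addnn addSnnS.
Qed.

(** Descent from m: if T_k < a^k, then T_(k+1)^k <= T_k^(k+1) < a^(k(k+1)), against the bound
    already known for T_(k+1). *)
Lemma maclaurin_lower (T : nat -> R) m a : T 0%N = 1 -> 0 < a ->
  (forall k, T k * T k.+2 <= T k.+1 ^ 2) ->
  (forall p, (1 <= p)%N -> (p <= m)%N -> 0 < T p) ->
  a ^ m <= T m -> forall p, (p <= m)%N -> a ^ p <= T p.
Proof.
move=> T0 a0 N P Tm p pm; have {N}S := maclaurin_step T0 N P.
rewrite -(subKn pm); elim: (m - p)%N (leq_subr p m) => [|d IH] dm; first by rewrite subn0.
have {IH} := IH (ltnW dm); have := S (m - d.+1)%N; rewrite -subSn// subSS.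
set k := (m - d.+1)%N => Sk; have e : (m - d = k.+1)%N by rewrite /k subnSK.
rewrite e in Sk *; have {Sk}h : T k.+1 ^ k <= T k ^ k.+1 by apply: Sk; rewrite -e leq_subr.
move=> Tk1; case: (Rle_lt_dec (a ^ k) (T k)) => // Tk; exfalso.
have Tk0 : 0 < T k.
  have [k0|k0] := posnP k; first by rewrite k0 T0; lra.
  by apply: P => //; rewrite /k leq_subr.
have : T k ^ k.+1 < (a ^ k) ^ k.+1.
  rewrite -!tech_pow_Rmult; apply: (Rle_lt_trans _ (T k * (a ^ k) ^ k)).
    by apply: Rmult_le_compat_l; [lra | apply: pow_incr; lra].
  by apply: Rmult_lt_compat_r => //; apply/pow_lt/pow_lt.
have : (a ^ k.+1) ^ k <= T k.+1 ^ k by apply: pow_incr; split => //; apply/pow_le/Rlt_le.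
by rewrite -!pow_mult Nat.mul_comm; lra.
Qed.

Lemma cone_gap n m (A : 'I_n -> 'I_n -> R) nu : (1 <= m)%N ->
  (forall i j, A i j = A j i) -> Km m A -> 0 < nu -> nu <= Tp m A ->
  forall p, (p <= m)%N -> Rmin 1 nu ^ p <= Tp p A.
Proof.
move=> m1 As Am nu0 Tm; have a0 : 0 < Rmin 1 nu by apply: Rmin_glb_lt; lra.
apply: (@maclaurin_lower (fun p => Tp p A)) => //; first exact: Tp0.
  by move=> k; exact: Tp_newton.
(* The base [Rmin 1 nu] replaces an m-th root of nu: for m >= 1 its m-th power is at most itself,
   hence at most nu. *)
apply: Rle_trans Tm; apply: Rle_trans (Rmin_r 1 nu).
case: m m1 {Am} => // m _; rewrite -[X in _ <= X]Rmult_1_r; apply: Rmult_le_compat_l; first lra.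
by rewrite -[X in _ <= X](pow1 m); apply: pow_incr; split; [lra | exact: Rmin_l].
Qed.

(** Here s may be negative. Multiplying s T_(k+1) + T_(k+2) > 0 by T_k and using Newton gives
    T_(k+1) (s T_k + T_(k+1)) > 0, so positivity descends from the top index. This places W in the
    cone at the starting point, where only the Hessian is known to be m-positive. *)
Lemma Km_bord n m s (A : 'I_n -> 'I_n -> R) : (1 <= m)%N ->
  (forall i j, A i j = A j i) -> Km m A -> 0 < s * Tp (m - 1) A + Tp m A ->
  Km m (bord s A).
Proof.
case: m => // m _ As Am; rewrite subn1 /= => Em.
have pos p : (p <= m.+1)%N -> 0 < Tp p A.
  by case: p => [|p] pm; [rewrite Tp0; apply: Rlt_0_1 | exact: Am].
suff H d : (d <= m)%N -> 0 < s * Tp (m - d) A + Tp (m - d).+1 A.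
  move=> [//|p] _ pm; rewrite Tp_bord; have := H (m - p)%N (leq_subr _ _).
  by rewrite subKn.
elim: d => [|d IH] dm; first by rewrite subn0.
have {IH} := IH (ltnW dm); rewrite -(subnSK dm); set k := (m - d.+1)%N => IH.
have km : (k.+2 <= m.+1)%N by rewrite ltnS /k subnSK// leq_subr.
have p0 := pos k (ltnW (ltnW km)); have p1 := pos k.+1 (ltnW km); have p2 := pos k.+2 km.
have N := Tp_newton k As.
have := Rmult_lt_0_compat _ _ p0 IH.
by move=> h; apply: (Rmult_lt_reg_l (Tp k.+1 A)) => //; lra.
Qed.

(** * Compactness and calculus *)

Section EVT.
Import boolp classical_sets reals Rstruct_topology topology normedtype derive.
Import Order.TTheory GRing.Theory Num.Theory numFieldNormedType.Exports.
Local Open Scope ring_scope.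
Local Open Scope classical_set_scope.

Let pt n (v : 'rV[R]_n) : Defs.point n := fun i => v ord0 i.

Lemma rV_ballP n (v : 'rV[R]_n) (d : R) (w : 'rV[R]_n) : 0 < d ->
  pseudometric_structure.ball v d w <-> Defs.ball (pt v) d (pt w).
Proof.
move=> d0; split.
  by move=> [_ h] i; apply/RltP; have := h ord0 i; rewrite RabsE RminusE distrC.
move=> h; split=> // i j; rewrite ord1; have /RltP := h j.
by rewrite RabsE RminusE distrC.
Qed.

(** The closure of a subset of the compact cube [-M, M]^n. *)
Lemma clos_compact n (O : Defs.point n -> Prop) : is_bounded O -> 
  compact [set v : 'rV[R]_n | clos O (pt v)].
Proof.
move=> [M HM].
have -> : [set v : 'rV[R]_n | clos O (pt v)] = closure [set v : 'rV[R]_n | O (pt v)].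
  apply/seteqP; split => v /= Hv.
    move=> B /nbhs_ballP[d /= d0 dB]; have /RltP d0' := d0.
    have [y [Oy vy]] := Hv d d0'; exists (\row_i y i).
    have yE : pt (\row_i y i) = y by apply/funext => i; rewrite /pt mxE.
    by split; [rewrite /= yE | apply: dB; apply/rV_ballP => //; rewrite yE].
  move=> d /RltP d0; have [w [/= Ow vw]] := Hv _ (nbhsx_ballx v d d0).
  by exists (pt w); split=> //; apply/rV_ballP.
set B := [set v : 'rV[R]_n | forall i, `[- M, M]%classic (v ord0 i)].
have Bc : compact B.
  by apply: (@rV_compact R n (fun=> `[- M, M]%classic)) => i; exact: segment_compact.
apply: (subclosed_compact _ Bc); first exact: closed_closure.
have /closure_id -> : closed B by apply: compact_closed Bc; exact: norm_hausdorff.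
apply: closure_subset => v /= Ov i; rewrite /= in_itv /= -ler_norml.
by have /RleP := HM _ Ov i; rewrite RabsE.
Qed.

Lemma cont_on2_attains_max n (O : Defs.point n -> Prop) (a b : R) (f : Defs.point n -> R -> R) :
  is_bounded O -> (exists x, O x) -> (a <= b)%coqR ->
  cont_on2 (fun x t => clos O x /\ (a <= t <= b)%coqR) f ->
  exists x t, [/\ clos O x, (a <= t <= b)%coqR &
    forall y s, clos O y -> (a <= s <= b)%coqR -> (f y s <= f x t)%coqR].
Proof.
move=> Ob [x0 Ox0] ab fc.
pose K := [set v : 'rV[R]_n | clos O (pt v)] `*` `[a, b]%classic.
have KE v t : K (v, t) <-> clos O (pt v) /\ (a <= t <= b)%coqR.
  split=> -[/= h]; first by rewrite in_itv /= => /andP[/RleP ? /RleP ?].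
  by move=> [/RleP h1 /RleP h2]; split=> //=; rewrite in_itv /= h1.
have ptE y : pt (\row_i y i) = y by apply/funext => i; rewrite /pt mxE.
have := @compact_EVT_max _ _ (fun z : 'rV[R]_n * R => f (pt z.1) z.2) K.
case.
- exists (\row_i x0 i, a); apply/KE; rewrite ptE; split.
    by move=> r r0; exists x0; split=> // i; rewrite RminusE subrr Rabs_R0.
  by split; [exact: Rle_refl |].
- by apply: compact_setX; [exact: clos_compact | exact: segment_compact].
- apply/subspace_continuousP => -[v t] /KE Kvt; apply/cvgrPdist_lt => e /RltP e0.
  have [d [/RltP d0 dP]] := fc _ _ Kvt _ e0.
  apply/nbhs_ballP; exists d => //= -[w s] [/= vw ts] /KE Kws.
  have st : (Rabs (s - t) < d)%coqR by apply/RltP; rewrite RabsE RminusE distrC.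
  have /RltP := dP _ _ Kws (proj1 (rV_ballP _ _ d0) vw) st.
  by rewrite RabsE RminusE distrC.
- move=> -[v t] /set_mem /KE[Kv Kt] Kmax; exists (pt v), t; split=> // y s Ky Ks.
  by apply/RleP; have := Kmax (\row_i y i, s); rewrite /= ptE; apply; apply/mem_set/KE; rewrite ptE.
Qed.
End EVT.

Lemma derivable_pt_lim_eq f g x l : f =1 g -> derivable_pt_lim f x l -> derivable_pt_lim g x l.
Proof. by move=> /functional_extensionality ->. Qed.

Lemma mvt_between f f' a b :
  (forall c, Rmin a b <= c <= Rmax a b -> derivable_pt_lim f c (f' c)) ->
  exists c, Rmin a b <= c <= Rmax a b /\ f b - f a = f' c * (b - a).
Proof.
move=> D; case: (Rtotal_order a b) => [ab|[ab|ab]].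
- rewrite Rmin_left ?Rmax_right in D *; try lra.
  by have [c [e cab]] := MVT_cor2 f f' a b ab D; exists c; split; lra.
- by exists a; rewrite ab Rmin_left ?Rmax_left; lra.
- rewrite Rmin_right ?Rmax_left in D *; try lra.
  by have [c [e cab]] := MVT_cor2 f f' b a ab D; exists c; split; lra.
Qed.

(** If g2 > 0, then g1 lies above g1(0) just to the right of 0 and below it just to the left. The
    sign of g1(0) selects the side on which the mean value theorem makes g exceed g(0). *)
Lemma second_derivative_max g g1 g2 r : 0 < r ->
  (forall s, Rabs s < r -> derivable_pt_lim g s (g1 s)) ->
  derivable_pt_lim g1 0 g2 -> (forall s, Rabs s < r -> g s <= g 0) -> g2 <= 0.
Proof.
move=> r0 D D2 gmax; apply: Rnot_lt_le => g20.
have [d dP] := D2 (g2 / 2) ltac:(lra).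
have key h : h <> 0 -> Rabs h < d -> 0 < (g1 h - g1 0) / h.
  by move=> h0 hd; have := dP h h0 hd; rewrite Rplus_0_l => /Rabs_def2; lra.
set e := Rmin d r / 2; have d0 := cond_pos d.
have e0 : 0 < Rmin d r by apply: Rmin_glb_lt.
have [ed er] : e < d /\ e < r by rewrite /e; have := Rmin_l d r; have := Rmin_r d r; lra.
have e1 : 0 < e by rewrite /e; lra.
case: (Rle_lt_dec 0 (g1 0)) => g10.
  have [c cr] : exists c, g e - g 0 = g1 c * (e - 0) /\ 0 < c < e.
    by apply: MVT_cor2 => // c ce; apply: D; rewrite Rabs_pos_eq; lra.
  have := key c ltac:(lra) ltac:(rewrite Rabs_pos_eq; lra).
  have := gmax e ltac:(rewrite Rabs_pos_eq; lra).
  case: cr => e2 cr => h k.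
  have : 0 < g1 c - g1 0.
    by have := Rmult_lt_0_compat _ c k ltac:(lra); rewrite /Rdiv Rmult_assoc Rinv_l; lra.
  by move=> h1; have := Rmult_lt_0_compat (g1 c) (e - 0) ltac:(lra) ltac:(lra); lra.
have [c cr] : exists c, g 0 - g (- e) = g1 c * (0 - (- e)) /\ - e < c < 0.
  by apply: MVT_cor2 => [|c ce]; [lra | apply: D; rewrite Rabs_left1; lra].
have := key c ltac:(lra) ltac:(rewrite Rabs_left1; lra).
have := gmax (- e) ltac:(rewrite Rabs_left1; lra).
case: cr => h cr h' k.
have : g1 c - g1 0 < 0.
  by have := Rmult_lt_0_compat _ (- c) k ltac:(lra); rewrite /Rdiv Rmult_assoc -Ropp_mult_distr_r Rinv_l; lra.
by move=> h1; have := Rmult_lt_0_compat (- g1 c) e ltac:(lra) ltac:(lra); lra.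
Qed.

(** One-sided on purpose: a maximum over a space-time cylinder may sit at the final time, so only
    the past is compared and only a sign results. *)
Lemma left_derivative_max g l a t : a < t -> derivable_pt_lim g t l ->
  (forall s, a <= s <= t -> g s <= g t) -> 0 <= l.
Proof.
move=> at_ D gmax; apply: Rnot_lt_le => l0.
have [d dP] := D (- l) ltac:(lra); have d0 := cond_pos d.
set e := Rmin d (t - a) / 2.
have e0 : 0 < Rmin d (t - a) by apply: Rmin_glb_lt; lra.
have [ed er] : e < d /\ e < t - a by rewrite /e; have := Rmin_l d (t - a); have := Rmin_r d (t - a); lra.
have e1 : 0 < e by rewrite /e; lra.
have := dP (- e) ltac:(lra) ltac:(rewrite Rabs_left1; lra).
move=> /Rabs_def2[h _]; have := gmax (t + - e) ltac:(lra).
have -> : g (t + - e) = (g (t + - e) - g t) / - e * - e + g t by field; lra.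
by have := Rmult_lt_0_compat (- ((g (t + - e) - g t) / - e)) e ltac:(lra) ltac:(lra); lra.
Qed.

Lemma finite_bound (T : eqType) (f : T -> R) (s : seq T) :
  exists K, 0 <= K /\ forall j, j \in s -> Rabs (f j) <= K.
Proof.
elim: s => [|x s [K [K0 HK]]]; first by exists 0; split=> //; lra.
exists (Rmax (Rabs (f x)) K); split; first by apply: Rle_trans (Rmax_r _ _).
move=> j; rewrite inE => /orP[/eqP->|/HK h]; first exact: Rmax_l.
by apply: Rle_trans (Rmax_r _ _).
Qed.

(** * Partial derivatives: lines, symmetry of the Hessian, second-order condition at a maximum *)

Section Partial.
Variable n : nat.
Implicit Types (x y : point n) (O : point n -> Prop).

Lemma upd_eq x i s : upd x i s i = s. Proof. by rewrite /upd eqxx. Qed.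
Lemma upd_upd x i s r : upd (upd x i s) i r = upd x i r.
Proof. by apply: functional_extensionality => j; rewrite /upd; case: eqP. Qed.
Lemma upd_id x i : upd x i (x i) = x.
Proof. by apply: functional_extensionality => j; rewrite /upd; case: eqP => [->|]. Qed.
Lemma upd_comm x i j s r : i != j -> upd (upd x i s) j r = upd (upd x j r) i s.
Proof.
move=> ij; apply: functional_extensionality => k; rewrite /upd.
by case: eqVneq => [->|] //; case: eqVneq => // e; rewrite e eqxx in ij.
Qed.

Lemma ball_center x r : 0 < r -> ball x r x.
Proof. by move=> r0 i; rewrite Rminus_diag_eq// Rabs_R0. Qed.

Lemma ball_upd x y r i s : ball x r y -> Rabs (s - x i) < r -> ball x r (upd y i s).
Proof. by move=> xy sx j; rewrite /upd; case: eqP => [->|_]. Qed.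

Lemma between_close (a b c z r : R) : Rmin a b <= c <= Rmax a b -> Rabs (a - z) < r -> Rabs (b - z) < r ->
  Rabs (c - z) < r.
Proof.
rewrite /Rmin /Rmax; case: Rle_dec => ab cab /Rabs_def2 h1 /Rabs_def2 h2; apply: Rabs_def1; lra.
Qed.

Definition has_partials O (F : point n -> R) (DF : 'I_n -> point n -> R) :=
  forall i x, O x -> derivable_pt_lim (fun s => F (upd x i s)) (x i) (DF i x).

Lemma partial_upd O F DF i z s : has_partials O F DF -> O (upd z i s) ->
  derivable_pt_lim (fun r => F (upd z i r)) s (DF i (upd z i s)).
Proof.
move=> HF Oz; have := HF i _ Oz; rewrite upd_eq; apply: derivable_pt_lim_eq => r.
by rewrite upd_upd.
Qed.

(** Only the coordinates in [l] move. Adding one more coordinate c changes F by a one-variable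
    increment, which the mean value theorem evaluates at an intermediate point; continuity of [DF c]
    brings that point back to x. *)
Lemma derivable_line_seq O F DF x xi (l : seq 'I_n) : is_open O -> O x ->
  has_partials O F DF -> (forall i, cont_on O (DF i)) -> uniq l ->
  derivable_pt_lim (fun s => F (fun j => if j \in l then x j + s * xi j else x j)) 0
    (Rsum [seq xi i * DF i x | i <- l]).
Proof.
move=> Oo Ox HF HD; elim: l => [|c l IH] /=; first by move=> _; exact: derivable_pt_lim_const.
move=> /andP[cl /IH{}IH].
set z := fun (s : R) (j : 'I_n) => if j \in l then x j + s * xi j else x j.
set z' := fun (s : R) (j : 'I_n) => if j \in c :: l then x j + s * xi j else x j.
have z'E s : z' s = upd (z s) c (x c + s * xi c).
  apply: functional_extensionality => j; rewrite /z' /z /upd inE.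
  by case: eqP => [->|].
have zE s : z s = upd (z s) c (x c).
  by apply: functional_extensionality => j; rewrite /z /upd; case: eqP => // ->; rewrite (negPf cl).
suff D : derivable_pt_lim (fun s => F (z' s) - F (z s)) 0 (xi c * DF c x).
  have := derivable_pt_lim_plus _ _ _ _ _ D IH; apply: derivable_pt_lim_eq => s.
  by change (F (z' s) - F (z s) + F (z s) = F (z' s)); lra.
have z0 : z 0 = x.
  by apply: functional_extensionality => j; rewrite /z; case: ifP => // _; lra.
have z'0 : z' 0 = x.
  by apply: functional_extensionality => j; rewrite /z'; case: ifP => // _; lra.
move=> eps eps0; have [r [r0 rO]] := Oo x Ox.
have [K [K0 HK]] := finite_bound xi (enum 'I_n).
have {}HK j : Rabs (xi j) <= K by apply: HK; rewrite mem_enum.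
(* K may be 0, so the division is by K + 1; moreover K / (K + 1) < 1 makes the final estimate
   strict. *)
have [d [d0 dP]] := HD c x Ox (eps / (K + 1)) ltac:(apply: Rdiv_lt_0_compat; lra).
have m0 : 0 < Rmin d r by apply: Rmin_glb_lt.
have delta0 : 0 < Rmin d r / (K + 1) by apply: Rdiv_lt_0_compat; lra.
exists (mkposreal _ delta0) => h h0 /= hd.
have hK j : Rabs (h * xi j) < Rmin d r.
  rewrite Rabs_mult; apply: (Rle_lt_trans _ (Rabs h * (K + 1))).
    by apply: Rmult_le_compat_l; [exact: Rabs_pos | have := HK j; lra].
  have := Rmult_lt_compat_r (K + 1) _ _ ltac:(lra) hd; rewrite /Rdiv Rmult_assoc Rinv_l; lra.
have zb : ball x (Rmin d r) (z h).
  move=> j; rewrite /z; case: ifP => _; last by rewrite Rminus_diag_eq// Rabs_R0.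
  by have -> : x j + h * xi j - x j = h * xi j by ring.
have ub th : Rmin (x c) (x c + h * xi c) <= th <= Rmax (x c) (x c + h * xi c) ->
    ball x (Rmin d r) (upd (z h) c th).
  move=> Hth; apply: ball_upd => //; apply: between_close Hth _ _.
    by rewrite Rminus_diag_eq// Rabs_R0.
  by have -> : x c + h * xi c - x c = h * xi c by ring.
have wk y r1 r2 : r1 <= r2 -> ball x r1 y -> ball x r2 y.
  by move=> r12 b j; apply: Rlt_le_trans (b j) r12.
have Or th : Rmin (x c) (x c + h * xi c) <= th <= Rmax (x c) (x c + h * xi c) -> O (upd (z h) c th).
  by move=> Hth; apply: rO; apply: wk (ub _ Hth); exact: Rmin_r.
have [th [Hth e]] := mvt_between (fun th Hth => partial_upd HF (Or th Hth)).
rewrite !Rplus_0_l z0 z'0 z'E {2}zE e.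
have -> : (DF c (upd (z h) c th) * (x c + h * xi c - x c) - (F x - F x)) / h - xi c * DF c x =
   xi c * (DF c (upd (z h) c th) - DF c x) by field.
rewrite Rabs_mult.
have := dP _ (Or _ Hth) (wk _ _ _ (Rmin_l d r) (ub _ Hth)) => lt1.
apply: (Rle_lt_trans _ (K * (eps / (K + 1)))).
  by apply: Rmult_le_compat; [exact: Rabs_pos | exact: Rabs_pos | exact: HK | exact: Rlt_le].
have -> : K * (eps / (K + 1)) = eps - eps / (K + 1) by field; lra.
have : 0 < eps / (K + 1) by apply: Rdiv_lt_0_compat; lra.
lra.
Qed.

Lemma derivable_line O F DF x xi s0 : is_open O ->
  has_partials O F DF -> (forall i, cont_on O (DF i)) ->
  O (fun j => x j + s0 * xi j) ->
  derivable_pt_lim (fun s => F (fun j => x j + s * xi j)) s0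
    (Rsum [seq xi i * DF i (fun j => x j + s0 * xi j) | i <- enum 'I_n]).
Proof.
move=> Oo HF HD Ox; have := derivable_line_seq xi Oo Ox HF HD (enum_uniq 'I_n).
move=> H eps eps0; have [d dP] := H eps eps0; exists d => h h0 hd.
have := dP h h0 hd.
have E s : (fun j => if j \in enum 'I_n then x j + s0 * xi j + s * xi j else x j + s0 * xi j) =
   (fun j => x j + (s0 + s) * xi j).
  by apply: functional_extensionality => j; rewrite mem_enum inE; ring.
by rewrite !E !Rplus_0_l Rplus_0_r.
Qed.

(** The left side is symmetric in i and j, whereas the right side differentiates first in i and then
    in j; applying this in both orders yields [schwarz]. *)
Lemma second_difference O F D1 D2 x r h i j : is_open O -> 0 < h < r -> i != j ->
  (forall y, ball x r y -> O y) ->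
  has_partials O F D1 -> (forall i, has_partials O (D1 i) (D2 i)) ->
  exists y, ball x r y /\
    F (upd (upd x j (x j + h)) i (x i + h)) - F (upd x i (x i + h)) -
    F (upd x j (x j + h)) + F x = h * h * D2 i j y.
Proof.
move=> Oo hr ij rO HF HD.
have bi c k : x k <= c <= x k + h -> Rabs (c - x k) < r.
  by move=> Hc; rewrite Rabs_pos_eq; lra.
have O1 y c k : ball x r y -> x k <= c <= x k + h -> ball x r (upd y k c).
  by move=> b /bi; exact: ball_upd.
have bx : ball x r x by apply: ball_center; lra.
have bxj := O1 _ (x j + h) j bx ltac:(lra).
have [c [e hc]] := MVT_cor2
   (fun s => F (upd (upd x j (x j + h)) i s) - F (upd x i s))
   (fun s => D1 i (upd (upd x j (x j + h)) i s) - D1 i (upd x i s)) (x i) (x i + h) ltac:(lra)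
   ltac:(move=> c Hc; apply: derivable_pt_lim_minus; apply: (partial_upd HF); apply: rO; exact: O1).
have bxi := O1 _ c i bx ltac:(lra).
have [c' [e' hc']] := MVT_cor2
   (fun s => D1 i (upd (upd x i c) j s)) (fun s => D2 i j (upd (upd x i c) j s)) (x j) (x j + h) ltac:(lra)
   ltac:(move=> c' Hc; apply: (partial_upd (HD i)); apply: rO; exact: O1).
exists (upd (upd x i c) j c'); split; first by apply: O1 => //; lra.
have xj : upd (upd x i c) j (x j) = upd x i c by rewrite upd_comm// upd_id.
have xi : upd (upd x j (x j + h)) i (x i) = upd x j (x j + h).
  by rewrite upd_comm 1?eq_sym// upd_id.
move: e e'; rewrite xj xi upd_id [upd (upd x i c) j _]upd_comm// => e e'.
have -> : h * h * D2 i j (upd (upd x i c) j c') = D2 i j (upd (upd x i c) j c') * (x j + h - x j) * h by ring.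
by rewrite -e'; lra.
Qed.

(** The Hessians are given only as iterated partials; their symmetry is what gives access to the
    spectral results. *)
Lemma schwarz O F D1 D2 x : is_open O -> O x ->
  has_partials O F D1 -> (forall i, has_partials O (D1 i) (D2 i)) ->
  (forall i j, cont_on O (D2 i j)) -> forall i j, D2 i j x = D2 j i x.
Proof.
move=> Oo Ox HF HD C i j; have [->//|ij] := eqVneq i j.
apply: cond_eq => eps eps0; have [r [r0 rO]] := Oo x Ox.
have [d1 [d10 H1]] := C i j x Ox (eps / 2) ltac:(lra).
have [d2 [d20 H2]] := C j i x Ox (eps / 2) ltac:(lra).
set d := Rmin r (Rmin d1 d2).
have d0 : 0 < d by apply: Rmin_glb_lt => //; apply: Rmin_glb_lt.
have dr : d <= r by exact: Rmin_l.
have dd1 : d <= d1 by apply: Rle_trans (Rmin_r _ _) (Rmin_l _ _).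
have dd2 : d <= d2 by apply: Rle_trans (Rmin_r _ _) (Rmin_r _ _).
have wk y r2 : d <= r2 -> ball x d y -> ball x r2 y.
  by move=> r12 b k; apply: Rlt_le_trans (b k) r12.
have dO y : ball x d y -> O y by move=> b; apply: rO; exact: wk b.
have [y1 [b1 e1]] := second_difference Oo (h := d / 2) (r := d) ltac:(lra) ij dO HF HD.
have [y2 [b2 e2]] := second_difference Oo (h := d / 2) (r := d) (i := j) (j := i)
  ltac:(lra) ltac:(by rewrite eq_sym) dO HF HD.
have e : D2 i j y1 = D2 j i y2.
  apply: (Rmult_eq_reg_l (d / 2 * (d / 2))); last first.
    by have := Rmult_lt_0_compat (d / 2) (d / 2) ltac:(lra) ltac:(lra); lra.
  by rewrite -e1 -e2 upd_comm 1?eq_sym//; ring.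
have := H1 _ (dO _ b1) (wk _ _ dd1 b1); have := H2 _ (dO _ b2) (wk _ _ dd2 b2).
rewrite e => /Rabs_def2 h1 /Rabs_def2 h2; apply: Rabs_def1; lra.
Qed.

Lemma hessian_max O F D1 D2 x : is_open O -> O x ->
  has_partials O F D1 -> (forall i, has_partials O (D1 i) (D2 i)) ->
  (forall i, cont_on O (D1 i)) -> (forall i j, cont_on O (D2 i j)) ->
  (forall y, O y -> F y <= F x) -> forall xi, quad (fun i j => D2 i j x) xi <= 0.
Proof.
move=> Oo Ox HF HD C1 C2 Fmax xi; have [r [r0 rO]] := Oo x Ox.
have [K [K0 HK]] := finite_bound xi (enum 'I_n).
have {}HK j : Rabs (xi j) <= K by apply: HK; rewrite mem_enum.
have rK0 : 0 < r / (K + 1) by apply: Rdiv_lt_0_compat; lra.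
have lineO s : Rabs s < r / (K + 1) -> O (fun j => x j + s * xi j).
  move=> sK; apply: rO => j; have -> : x j + s * xi j - x j = s * xi j by ring.
  rewrite Rabs_mult; apply: (Rle_lt_trans _ (Rabs s * (K + 1))).
    by apply: Rmult_le_compat_l; [exact: Rabs_pos | have := HK j; lra].
  have := Rmult_lt_compat_r (K + 1) _ _ ltac:(lra) sK; rewrite /Rdiv Rmult_assoc Rinv_l; lra.
have x0E : (fun j => x j + 0 * xi j) = x by apply: functional_extensionality => j; ring.
have D1' s : Rabs s < r / (K + 1) -> _ := fun hs => derivable_line Oo HF C1 (lineO s hs).
suff D2' : derivable_pt_lim (fun s => Rsum [seq xi i * D1 i (fun j => x j + s * xi j) | i <- enum 'I_n]) 0
    (quad (fun i j => D2 i j x) xi).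
  apply: (second_derivative_max rK0 D1' D2') => s hs /=.
  by rewrite x0E; apply: Fmax; exact: lineO.
have -> : quad (fun i j => D2 i j x) xi =
   Rsum [seq xi i * Rsum [seq xi j * D2 i j x | j <- enum 'I_n] | i <- enum 'I_n].
  rewrite RsumE /quad big_map big_enum /=; apply: eq_bigr => i _.
  rewrite RsumE big_map big_enum /= RmultE GRing.mulr_sumr; apply: eq_bigr => j _.
  by rewrite RmultE -GRing.mulrA; congr (_ * _)%R; rewrite GRing.mulrC.
suff G l : derivable_pt_lim (fun s => Rsum [seq xi i * D1 i (fun j => x j + s * xi j) | i <- l]) 0
    (Rsum [seq xi i * Rsum [seq xi j * D2 i j x | j <- enum 'I_n] | i <- l]) by exact: G.
elim: l => [|i l IH] /=; first exact: derivable_pt_lim_const.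
apply: derivable_pt_lim_plus IH; apply: derivable_pt_lim_scal.
have := derivable_line (x := x) (xi := xi) (s0 := 0) Oo (HD i) (C2 i).
by rewrite x0E; apply.
Qed.
End Partial.

(** * Joint continuity in space and time *)

Section Continuity.
Variable n : nat.
Implicit Types (D : point n -> R -> Prop) (f g : point n -> R -> R).

Lemma cont_on2_sub D D' f : (forall x t, D' x t -> D x t) -> cont_on2 D f -> cont_on2 D' f.
Proof.
move=> sub C x t Dx eps eps0; have [d [d0 H]] := C x t (sub _ _ Dx) eps eps0.
by exists d; split=> // y s Dy; apply: H; exact: sub.
Qed.

Lemma cont_on2_op (op : R -> R -> R) D f g :
  (forall a b eps, 0 < eps -> exists d, 0 < d /\ forall a' b', Rabs (a' - a) < d -> Rabs (b' - b) < d ->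
     Rabs (op a' b' - op a b) < eps) ->
  cont_on2 D f -> cont_on2 D g -> cont_on2 D (fun x t => op (f x t) (g x t)).
Proof.
move=> Cop Cf Cg x t Dx eps eps0; have [d [d0 H]] := Cop (f x t) (g x t) eps eps0.
have [d1 [d10 H1]] := Cf x t Dx d d0; have [d2 [d20 H2]] := Cg x t Dx d d0.
exists (Rmin d1 d2); split; first exact: Rmin_glb_lt.
move=> y s Dy b st; apply: H.
  by apply: H1 => // [i|]; [apply: Rlt_le_trans (b i) _ | apply: Rlt_le_trans st _]; exact: Rmin_l.
by apply: H2 => // [i|]; [apply: Rlt_le_trans (b i) _ | apply: Rlt_le_trans st _]; exact: Rmin_r.
Qed.

Lemma cont_on2_plus D f g : cont_on2 D f -> cont_on2 D g -> cont_on2 D (fun x t => f x t + g x t).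
Proof.
apply: cont_on2_op => a b eps eps0; exists (eps / 2); split; first lra.
by move=> a' b' /Rabs_def2 ? /Rabs_def2 ?; apply: Rabs_def1; lra.
Qed.

Lemma cont_on2_minus D f g : cont_on2 D f -> cont_on2 D g -> cont_on2 D (fun x t => f x t - g x t).
Proof.
apply: cont_on2_op => a b eps eps0; exists (eps / 2); split; first lra.
by move=> a' b' /Rabs_def2 ? /Rabs_def2 ?; apply: Rabs_def1; lra.
Qed.

Lemma cont_on2_mult D f g : cont_on2 D f -> cont_on2 D g -> cont_on2 D (fun x t => f x t * g x t).
Proof.
apply: cont_on2_op => a b eps eps0.
have a0 := Rabs_pos a; have b0 := Rabs_pos b; set K := Rabs a + Rabs b + 1.
have K0 : 0 < K by rewrite /K; lra.
have e0 : 0 < eps / K by apply: Rdiv_lt_0_compat.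
exists (Rmin 1 (eps / K)); split; first by apply: Rmin_glb_lt; lra.
move=> a' b' ha hb; have h1 := Rmin_l 1 (eps / K); have h2 := Rmin_r 1 (eps / K).
have -> : a' * b' - a * b = a' * (b' - b) + b * (a' - a) by ring.
apply: Rle_lt_trans (Rabs_triang _ _) _; rewrite !Rabs_mult.
have ha' : Rabs a' <= Rabs a + 1.
  have -> : a' = a + (a' - a) by ring.
  by apply: Rle_trans (Rabs_triang _ _) _; lra.
have -> : eps = (Rabs a + 1) * (eps / K) + Rabs b * (eps / K) by rewrite /K; field; rewrite -/K; lra.
have p1 := Rabs_pos a'; have p2 := Rabs_pos (a' - a); have p3 := Rabs_pos (b' - b).
apply: Rplus_lt_le_compat.
  apply: (Rle_lt_trans _ ((Rabs a + 1) * Rabs (b' - b))).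
    exact: Rmult_le_compat_r.
  by apply: Rmult_lt_compat_l; lra.
by apply: Rmult_le_compat_l => //; lra.
Qed.

Lemma cont_on2_const D c : cont_on2 D (fun _ _ => c).
Proof. by move=> x t _ eps eps0; exists 1; split; [lra | move=> *; rewrite Rminus_diag_eq// Rabs_R0]. Qed.

Lemma cont_on2_time D (h : R -> R) : (forall t, continuity_pt h t) -> cont_on2 D (fun _ t => h t).
Proof.
move=> C x t _ eps eps0; have [d [d0 H]] := C t eps eps0; exists d; split=> // y s _ _ st.
have [->|ts] := Req_dec s t; first by rewrite Rminus_diag_eq// Rabs_R0.
by apply: H; split=> //; split=> //; apply: not_eq_sym.
Qed.

Lemma cont_on2_space D (S : point n -> Prop) (h : point n -> R) : (forall x t, D x t -> S x) ->
  cont_on S h -> cont_on2 D (fun x _ => h x).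
Proof.
move=> sub C x t /sub Dx eps eps0; have [d [d0 H]] := C x Dx eps eps0.
by exists d; split=> // y s /sub Dy b _; exact: H.
Qed.

Lemma cont_on2_Tp N p D (A : point n -> R -> 'I_N -> 'I_N -> R) :
  (forall i j, cont_on2 D (fun x t => A x t i j)) -> cont_on2 D (fun x t => Tp p (A x t)).
Proof.
move=> HA; pose Q (f : point n * R -> R) := cont_on2 D (fun x t => f (x, t)).
have Q1 c : Q (fun=> c) by exact: cont_on2_const.
have Q2 (f g : point n * R -> R) : Q f -> Q g -> Q (fun z => f z + g z) by exact: cont_on2_plus.
have Q3 (f g : point n * R -> R) : Q f -> Q g -> Q (fun z => f z * g z) by exact: cont_on2_mult.
exact: (Tp_closed Q1 Q2 Q3 p (A := fun z => A z.1 z.2) HA).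
Qed.

Lemma cont_on_slice D f t : cont_on2 D f -> cont_on (fun x => D x t) (fun x => f x t).
Proof.
move=> C x Dx eps eps0; have [d [d0 H]] := C x t Dx eps eps0; exists d; split=> // y Dy b.
by apply: H => //; rewrite Rminus_diag_eq// Rabs_R0.
Qed.

Lemma cont_on_lincomb (O : point n -> Prop) c a (f g : point n -> R) :
  cont_on O f -> cont_on O g -> cont_on O (fun x => c * (f x - a * g x)).
Proof.
move=> Cf Cg; pose D (x : point n) (_ : R) := O x.
have C h : cont_on O h -> cont_on2 D (fun x _ => h x) by apply: cont_on2_space => x t.
have K b : cont_on2 D (fun _ _ => b) by exact: cont_on2_const.
apply: (cont_on_slice (D := D) (t := 0) (f := fun x _ => c * (f x - a * g x))).
exact: cont_on2_mult (K c) (cont_on2_minus (C _ Cf) (cont_on2_mult (K a) (C _ Cg))).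
Qed.

Lemma subset_clos (O : point n -> Prop) x : O x -> clos O x.
Proof. by move=> Ox r r0; exists x; split=> //; exact: ball_center. Qed.

Lemma cont_on_attains_max (O : point n -> Prop) (g : point n -> R) :
  is_bounded O -> (exists x, O x) -> cont_on (clos O) g ->
  exists x, clos O x /\ forall y, clos O y -> g y <= g x.
Proof.
move=> Ob O0 C; have [|x [t [Ox _ H]]] := @cont_on2_attains_max n O 0 0 (fun x _ => g x) Ob O0 (Rle_refl 0).
  by apply: cont_on2_space C => x t [].
by exists x; split=> // y Oy; apply: (H y 0) => //; lra.
Qed.
End Continuity.

Lemma pow_le_pow a p q : 0 <= a <= 1 -> (p <= q)%N -> a ^ q <= a ^ p.
Proof.
move=> a01 /subnK <-; rewrite -plusE pow_add -[X in _ <= X]Rmult_1_l.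
apply: Rmult_le_compat_r; first by apply: pow_le; lra.
by rewrite -(pow1 (q - p)); apply: pow_incr.
Qed.

(** Connectedness of a half-line. At the supremum s of the times up to which P has held throughout,
    local constancy gives P at s and beyond it. *)
Lemma locally_constant_true (P : R -> Prop) a : P a ->
  (forall t, a <= t -> exists d, 0 < d /\ forall s, a <= s -> Rabs (s - t) < d -> (P t <-> P s)) ->
  forall t, a <= t -> P t.
Proof.
move=> Pa L t at_; apply: NNPP => nPt.
pose E s := a <= s <= t /\ forall r, a <= r <= s -> P r.
have [s [ub lub]] : {s | is_lub E s}.
  apply: completeness; first by exists t => s [[]].
  by exists a; split=> [|r ra]; [lra | have -> : r = a by lra].
have as_ : a <= s by apply: ub; split=> [|r ra]; [lra | have -> : r = a by lra].
have st : s <= t by apply: lub => r [[]].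
have [d [d0 H]] := L s as_.
have below r : a <= r < s -> P r.
  move=> [ar rs]; apply: NNPP => nPr; have : s <= r; last lra.
  by apply: lub => q [aq Pq]; apply: Rnot_lt_le => rq; apply: nPr; apply: Pq; lra.
have Ps : P s.
  have [sa|sa] := Req_dec s a; first by rewrite sa.
  have m1 := Rmax_l a (s - d / 2); have m2 := Rmax_r a (s - d / 2).
  have m3 : Rmax a (s - d / 2) < s by apply: Rmax_lub_lt; lra.
  apply/(H (Rmax a (s - d / 2))) => //; last by apply: below.
  by apply: Rabs_def1; lra.
have Pn r : a <= r < s + d -> P r.
  move=> ar; case: (Rlt_le_dec r s) => rs; first by apply: below; lra.
  by apply/(H r); [lra | rewrite Rabs_pos_eq; lra |].
have nt : ~ t < s + d by move=> ts; apply: nPt; apply: Pn; lra.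
have : s + d / 2 <= s; last lra.
by apply: ub; split; [lra | move=> r ar; apply: Pn; lra].
Qed.

Lemma interior_max n (O : point n -> Prop) w T t1 x1 : is_bounded O -> (exists x, O x) ->
  T <= t1 -> cont_on2 (fun x t => clos O x /\ T <= t <= t1) w ->
  (forall x, O x -> w x T <= 0) -> (forall x t, boundary O x -> T <= t -> w x t <= 0) ->
  clos O x1 -> 0 < w x1 t1 ->
  exists x t, [/\ O x, T < t <= t1, forall y, O y -> w y t <= w x t &
    forall s, T <= s <= t -> w x s <= w x t].
Proof.
move=> Ob O0 Tt C i0 b0 c1 w1; have [x [t [cx Tt' H]]] := cont_on2_attains_max Ob O0 Tt C.
have wx : 0 < w x t by apply: Rlt_le_trans w1 (H _ _ c1 _); lra.
have Ox : O x by apply: NNPP => nO; have := b0 x t (conj cx nO) ltac:(lra); lra.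
exists x, t; split=> //.
- split; last lra; have [e|] := Req_dec t T; last lra.
  by move: wx (i0 x Ox); rewrite e; lra.
- by move=> y Oy; apply: H => //; exact: subset_clos.
- by move=> s sT; apply: H => //; lra.
Qed.

(** * Evolution equation: cone preservation and barriers *)

Lemma Ropp_le_abs x : - x <= Rabs x.
Proof. by rewrite -Rabs_Ropp; exact: Rle_abs. Qed.

Section Evolution.
Variables (n m : nat) (Omega : point n -> Prop).
Hypothesis HOm : is_domain Omega.
Hypothesis HObd : is_bounded Omega.
Variables (bu : point n -> R) (bD1 : 'I_n -> point n -> R) (bD2 : 'I_n -> 'I_n -> point n -> R).
Hypothesis Hbu1 : has_partials Omega bu bD1.
Hypothesis Hbu2 : forall i, has_partials Omega (bD1 i) (bD2 i).
Hypothesis Hbuc : cont_on (clos Omega) bu.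
Hypothesis Hbuc1 : forall i, cont_on (clos Omega) (bD1 i).
Hypothesis Hbuc2 : forall i j, cont_on (clos Omega) (bD2 i j).
Hypothesis Hadm : forall x, clos Omega x -> Km m.+1 (fun i j => bD2 i j x).
Variables (u Ut : point n -> R -> R) (Ux : 'I_n -> point n -> R -> R)
  (Uxx : 'I_n -> 'I_n -> point n -> R -> R).
Hypothesis Huc : cont_on2 (fun x t => clos Omega x /\ 0 <= t) u.
Hypothesis Hut : forall x t, Omega x -> 0 < t -> derivable_pt_lim (fun s => u x s) t (Ut x t).
Hypothesis Hux : forall t, 0 < t -> has_partials Omega (fun x => u x t) (fun i x => Ux i x t).
Hypothesis Huxx : forall i t, 0 < t ->
  has_partials Omega (fun x => Ux i x t) (fun j x => Uxx i j x t).
Hypothesis Hutc : cont_on2 (fun x t => Omega x /\ 0 < t) Ut.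
Hypothesis Huxc : forall i, cont_on2 (fun x t => Omega x /\ 0 < t) (Ux i).
Hypothesis Huxxc : forall i j, cont_on2 (fun x t => Omega x /\ 0 < t) (Uxx i j).

Let A (x : point n) : 'I_n -> 'I_n -> R := fun i j => bD2 i j x.
Let S (x : point n) (t : R) : 'I_n -> 'I_n -> R := fun i j => Uxx i j x t.
Let W (x : point n) (t : R) := bord (- Ut x t) (S x t).
Let f (x : point n) := Tp m.+1 (A x).

Let Oopen : is_open Omega := proj1 (proj2 HOm).
Let Onemp : exists x, Omega x := proj1 HOm.

Lemma cont_on_inner (g : point n -> R) : cont_on (clos Omega) g -> cont_on Omega g.
Proof.
move=> C x Ox eps eps0; have [d [d0 H]] := C x (subset_clos Ox) eps eps0.
by exists d; split=> // y Oy; apply: H; exact: subset_clos.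
Qed.

Lemma cont_on_inner_time (g : point n -> R -> R) t : 0 < t ->
  cont_on2 (fun x t => Omega x /\ 0 < t) g -> cont_on Omega (fun x => g x t).
Proof.
move=> t0 C x Ox eps eps0; have [d [d0 H]] := C x t (conj Ox t0) eps eps0.
by exists d; split=> // y Oy b; apply: H => //; rewrite Rminus_diag_eq// Rabs_R0.
Qed.

Lemma A_sym x : Omega x -> forall i j, A x i j = A x j i.
Proof.
by move=> Ox; apply: (schwarz Oopen Ox Hbu1 Hbu2) => i j; exact: cont_on_inner.
Qed.

Lemma S_sym x t : Omega x -> 0 < t -> forall i j, S x t i j = S x t j i.
Proof.
move=> Ox t0; apply: (schwarz Oopen Ox (Hux t0) (D2 := fun i j x => Uxx i j x t)) => [i|i j].
  exact: Huxx.
exact: cont_on_inner_time.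
Qed.

Lemma A_pos x p : clos Omega x -> (p <= m.+1)%N -> 0 < Tp p (A x).
Proof.
by move=> cx; case: p => [|p] pm; [rewrite Tp0; exact: Rlt_0_1 | exact: (Hadm cx)].
Qed.

(** * Propagation of cone membership over the cylinder *)

Section Cone.
Variables (x0 : point n) (t0 nu : R).
Hypothesis Hx0 : Omega x0.
Hypothesis Ht0 : 0 < t0.
Hypothesis Hpos0 : Km m.+1 (S x0 t0).
Hypothesis Hnu : 0 < nu.
Hypothesis HE : forall x t, Omega x -> t0 <= t -> nu <= Tp m.+1 (W x t).

Lemma Km_locally_constant x t : Omega x -> t0 <= t ->
  exists d, 0 < d /\ forall y s, Omega y -> t0 <= s -> ball x d y -> Rabs (s - t) < d ->
    (Km m.+1 (W x t) <-> Km m.+1 (W y s)).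
Proof.
move=> Ox tt; set a := Rmin 1 nu.
have a0 : 0 < a by apply: Rmin_glb_lt; lra.
have a1 : a <= 1 by exact: Rmin_l.
have gap y s p : Omega y -> t0 <= s -> Km m.+1 (W y s) -> (p <= m.+1)%N -> a ^ m.+1 <= Tp p (W y s).
  move=> Oy s0 K pm; apply: (Rle_trans _ (a ^ p)).
    by apply: pow_le_pow => //; lra.
  apply: (cone_gap _ _ K Hnu) => //; last exact: HE.
  by apply/bord_sym/S_sym => //; lra.
(* A radius common to all p <= k, built one index at a time. *)
have near k eps : 0 < eps -> exists d, 0 < d /\ forall y s p, Omega y -> t0 <= s -> ball x d y ->
    Rabs (s - t) < d -> (p <= k)%N -> Rabs (Tp p (W y s) - Tp p (W x t)) < eps.
  elim: k eps => [|k IH] eps eps0.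
    exists 1; split; first lra.
    by move=> y s p _ _ _ _; rewrite leqn0 => /eqP->; rewrite !Tp0 Rminus_diag_eq// Rabs_R0.
  have [d1 [d10 H1]] := IH eps eps0.
  have C : cont_on2 (fun x t => Omega x /\ 0 < t) (fun x t => Tp k.+1 (W x t)).
    apply: cont_on2_Tp => i j; rewrite /W /bord.
    case: (unlift ord0 i) => [i'|]; case: (unlift ord0 j) => [j'|]; try exact: cont_on2_const.
      exact: Huxxc.
    have -> : (fun x t => - Ut x t) = (fun x t => 0 - Ut x t).
      by do 2!(apply: functional_extensionality => ?); ring.
    exact: (cont_on2_minus (cont_on2_const 0) Hutc).
  have [d2 [d20 H2]] := C x t (conj Ox (Rlt_le_trans _ _ _ Ht0 tt)) eps eps0.
  exists (Rmin d1 d2); split; first exact: Rmin_glb_lt.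
  move=> y s p Oy s0 b st; rewrite leq_eqVlt => /orP[/eqP->|pk].
    apply: H2; first by split=> //; lra.
      by move=> i; apply: Rlt_le_trans (b i) _; exact: Rmin_r.
    by apply: Rlt_le_trans st _; exact: Rmin_r.
  apply: H1 => //; first by move=> i; apply: Rlt_le_trans (b i) _; exact: Rmin_l.
  by apply: Rlt_le_trans st _; exact: Rmin_l.
(* The tolerance is the gap itself. Whichever of the two points is in the cone has all its T_p at
   least a^(m+1), so the other one keeps them positive. *)
have [d [d0 H]] := near m.+1 _ (pow_lt a m.+1 a0).
exists d; split=> // y s Oy s0 b st; split=> K p p1 pm.
  by have /Rabs_def2 := H y s p Oy s0 b st pm; have := gap _ _ _ Ox tt K pm; lra.
by have /Rabs_def2 := H y s p Oy s0 b st pm; have := gap _ _ _ Oy s0 K pm; lra.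
Qed.

Lemma W_in_cone x t : Omega x -> t0 <= t -> Km m.+1 (W x t).
Proof.
move=> Ox; apply: (locally_constant_true (P := fun t => Km m.+1 (W x t))) => {t} [|t tt]; last first.
  have [d [d0 H]] := Km_locally_constant Ox tt.
  by exists d; split=> // s s0 st; apply: H => //; exact: ball_center.
(* Used with P the identity and P the negation: at time t0 the good set and its complement in Omega
   are both open, so connectedness of Omega decides. Time was handled separately, at fixed x. *)
have opn (P : Prop -> Prop) : (forall Q Q', (Q <-> Q') -> P Q -> P Q') ->
    is_open (fun x => Omega x /\ P (Km m.+1 (W x t0))).
  move=> HP y [Oy Py]; have [d [d0 H]] := Km_locally_constant Oy (Rle_refl t0).
  have [r [r0 rO]] := Oopen Oy; exists (Rmin d r); split; first exact: Rmin_glb_lt.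
  move=> z b; have Oz : Omega z by apply: rO => i; apply: Rlt_le_trans (b i) (Rmin_r _ _).
  split=> //; apply: HP Py; apply: H => //; try lra.
    by move=> i; apply: Rlt_le_trans (b i) (Rmin_l _ _).
  by rewrite Rminus_diag_eq// Rabs_R0.
apply: NNPP => nK; have [_ [_ conn]] := HOm.
apply: (conn _ _ (opn id _) (opn not _)) => //.
- by move=> Q Q' [].
- by move=> Q Q' [h h'] nQ q; apply/nQ/h'.
- by move=> y Oy; case: (classic (Km m.+1 (W y t0))) => ?; [left | right].
- by move=> y Oy [[_ ?] [_]].
- exists x0; split=> //; split=> //; apply: Km_bord => //; first exact: S_sym.
  by have := HE Hx0 (Rle_refl t0); rewrite /W Tp_bord subn1 /=; lra.
- by exists x.
Qed.
End Cone.

(** A positive value of w forces an interior maximum after time T; the first-order condition in time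
    and the second-order one in space are read there. The factor c lets one statement serve
    comparison from above and from below. *)
Lemma compare_touch c al be al' be' T t1 x1 : 0 <= T <= t1 ->
  (forall t, derivable_pt_lim al t (al' t)) -> (forall t, derivable_pt_lim be t (be' t)) ->
  let w x t := c * (u x t - (al t * bu x + be t)) in
  (forall x, Omega x -> w x T <= 0) -> (forall x t, boundary Omega x -> T <= t -> w x t <= 0) ->
  clos Omega x1 -> 0 < w x1 t1 ->
  exists x t, [/\ Omega x, T < t <= t1, 0 <= c * (Ut x t - (al' t * bu x + be' t)) &
    forall xi, quad (fun i j => c * (S x t i j - al t * A x i j)) xi <= 0].
Proof.
move=> T0 Dal Dbe w w0 wb cx1 w1.
have Cal t : continuity_pt al t by apply: derivable_continuous_pt; exists (al' t); exact: Dal.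
have Cbe t : continuity_pt be t by apply: derivable_continuous_pt; exists (be' t); exact: Dbe.
have Cw : cont_on2 (fun x t => clos Omega x /\ T <= t <= t1) w.
  apply: cont_on2_mult; first exact: cont_on2_const.
  apply: cont_on2_minus.
  - by apply: cont_on2_sub Huc => x t [cx tT]; split=> //; lra.
  - apply: cont_on2_plus; last exact: cont_on2_time.
    apply: cont_on2_mult; first exact: cont_on2_time.
    by apply: (cont_on2_space (S := clos Omega)) => // x t [].
have [x [t [Ox tT xmax tmax]]] := interior_max HObd Onemp (proj2 T0) Cw w0 wb cx1 w1.
have t0 : 0 < t by lra.
exists x, t; split=> //.
  apply: (left_derivative_max (g := w x) (proj1 tT)) => //.
  have D := derivable_pt_lim_scal _ c _ _ (derivable_pt_lim_minus _ _ _ _ _ (Hut Ox t0)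
    (derivable_pt_lim_plus _ _ _ _ _ (derivable_pt_lim_scal _ (bu x) _ _ (Dal t)) (Dbe t))).
  have -> : al' t * bu x + be' t = bu x * al' t + be' t by ring.
  apply: derivable_pt_lim_eq D => s.
  by rewrite /mult_real_fct /minus_fct /plus_fct /w; ring.
apply: (hessian_max Oopen Ox (F := fun y => w y t)
   (D1 := fun i y => c * (Ux i y t - al t * bD1 i y))
   (D2 := fun i j y => c * (Uxx i j y t - al t * bD2 i j y))).
- move=> i y Oy; have D := derivable_pt_lim_scal _ c _ _ (derivable_pt_lim_minus _ _ _ _ _ (Hux t0 i Oy)
    (derivable_pt_lim_plus _ _ _ _ _ (derivable_pt_lim_scal _ (al t) _ _ (Hbu1 i Oy))
      (derivable_pt_lim_const (be t) (y i)))).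
  rewrite Rplus_0_r in D; apply: derivable_pt_lim_eq D => s.
  by rewrite /mult_real_fct /minus_fct /plus_fct /fct_cte /w.
- move=> i j y Oy; have D := derivable_pt_lim_scal _ c _ _ (derivable_pt_lim_minus _ _ _ _ _ (Huxx i t0 j Oy)
    (derivable_pt_lim_scal _ (al t) _ _ (Hbu2 i j Oy))).
  by apply: derivable_pt_lim_eq D => s.
- by move=> i; apply: cont_on_lincomb; [exact: cont_on_inner_time | exact: cont_on_inner].
- by move=> i j; apply: cont_on_lincomb; [exact: cont_on_inner_time | exact: cont_on_inner].
- by move=> y Oy; exact: xmax.
Qed.

(** * Barriers, boundedness and convergence *)

Section Barrier.
Variables (t0 : R) (h1 h2 hm : R -> R).
Hypothesis Ht0 : 0 < t0.
Hypothesis Hcone : forall x t, Omega x -> t0 <= t -> Km m.+1 (W x t).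
Hypothesis h1_pos : forall t, t0 <= t -> 0 < h1 t.
Hypothesis hm_pos : forall t, t0 <= t -> 0 < hm t.
Hypothesis h1_mono : forall s t, t0 <= s -> s <= t -> h1 t <= h1 s.
Hypothesis h2_mono : forall s t, t0 <= s -> s <= t -> h2 t <= h2 s.
Hypothesis hm_mono : forall s t, t0 <= s -> s <= t -> hm t <= hm s.
Hypothesis Hbdry : forall x t, boundary Omega x -> t0 <= t -> - hm t <= u x t - bu x <= h1 t.
Hypothesis Heq : forall x t, Omega x -> t0 <= t ->
  (1 - INR m.+1 * h2 t) * f x <= Tp m.+1 (W x t) <= (1 + INR m.+1 * hm t) * f x.

(** By compactness, (M - bu) T_p has a maximum and T_(p+1) a positive minimum. Every p <= m is
    covered because the lower barrier must be placed in the cone index by index. *)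
Lemma ratio_bound M : (forall x, clos Omega x -> bu x <= M) -> exists L, 0 <= L /\
  forall x p, clos Omega x -> (p <= m)%N -> (M - bu x) * Tp p (A x) <= L * Tp p.+1 (A x).
Proof.
move=> HM.
have CT p : cont_on (clos Omega) (fun x => Tp p (A x)).
  apply: (cont_on_slice (D := fun x _ => clos Omega x) (t := 0) (f := fun x _ => Tp p (A x))).
  by apply: cont_on2_Tp => i j; apply: cont_on2_space (Hbuc2 i j) => x t.
have one p : (p <= m)%N -> exists L, 0 <= L /\
  forall x, clos Omega x -> (M - bu x) * Tp p (A x) <= L * Tp p.+1 (A x).
  move=> pm.
  have CB : cont_on (clos Omega) (fun x => (M - bu x) * Tp p (A x)).
    apply: (cont_on_slice (D := fun x _ => clos Omega x) (t := 0) (f := fun x _ => (M - bu x) * Tp p (A x))).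
    apply: cont_on2_mult; last by apply: cont_on2_space (CT p) => x t.
    apply: cont_on2_minus; first exact: cont_on2_const.
    by apply: cont_on2_space Hbuc => x t.
  (* This function equals - T_(p+1), so its maximum is the minimum of T_(p+1). *)
  have CN : cont_on (clos Omega) (fun x => -1 * (Tp p.+1 (A x) - 0 * Tp p.+1 (A x))).
    exact: cont_on_lincomb.
  have [y [cy Hy]] := cont_on_attains_max HObd Onemp CB.
  have [z [cz Hz]] := cont_on_attains_max HObd Onemp CN.
  have z0 := A_pos cz (p := p.+1) pm.
  have y0 : 0 <= (M - bu y) * Tp p (A y).
    by apply: Rmult_le_pos; [have := HM y cy; lra | apply/Rlt_le/(A_pos cy)/leqW].
  exists ((M - bu y) * Tp p (A y) / Tp p.+1 (A z)); split.
    by apply: Rmult_le_pos => //; apply/Rlt_le/Rinv_0_lt_compat.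
  move=> x cx; apply: Rle_trans (Hy x cx) _; have := Hz x cx => hz.
  rewrite /Rdiv Rmult_assoc -[X in X <= _]Rmult_1_r; apply: Rmult_le_compat_l => //.
  apply: (Rmult_le_reg_l (Tp p.+1 (A z))) => //.
  by rewrite -Rmult_assoc Rinv_r ?Rmult_1_l ?Rmult_1_r; lra.
have {one}all k : (k <= m.+1)%N -> exists L, 0 <= L /\ forall x p, clos Omega x -> (p < k)%N ->
    (M - bu x) * Tp p (A x) <= L * Tp p.+1 (A x).
  elim: k => [|k IH] km; first by exists 0; split=> //; exact: Rle_refl.
  have [L1 [L10 H1]] := IH (ltnW km); have [L2 [L20 H2]] := one k km.
  exists (Rmax L1 L2); split; first exact: Rle_trans L10 (Rmax_l _ _).
  move=> x p cx; rewrite ltnS leq_eqVlt => /orP[/eqP->|pk].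
    apply: Rle_trans (H2 x cx) _; apply: Rmult_le_compat_r (Rmax_r _ _).
    by apply/Rlt_le/(A_pos cx).
  apply: Rle_trans (H1 x p cx pk) _; apply: Rmult_le_compat_r (Rmax_l _ _).
  by apply/Rlt_le/(A_pos cx)/(leq_trans pk (ltnW km)).
by have [L [L0 H]] := all m.+1 (leqnn _); exists L; split=> // x p cx pm; exact: H.
Qed.

Section Profile.
Variables (T ga ka la L M de : R).
Hypothesis HT : t0 <= T.
Hypothesis Hga : 0 < ga.
Hypothesis Hka : 0 <= ka.
Hypothesis Hla : 0 <= la.
Hypothesis HL : forall x p, clos Omega x -> (p <= m)%N -> (M - bu x) * Tp p (A x) <= L * Tp p.+1 (A x).
Hypothesis HlaL : la * L <= 1.
Hypothesis HM : forall x, clos Omega x -> bu x <= M.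

(** The transient part, with k' = - la k. It absorbs the gap present at time T, while [ga] provides
    the strict inequality in the equation. *)
Let k t := ka * exp (- la * (t - T)).
Let g t := ga + k t.

Lemma transient_ge0 t : 0 <= k t.
Proof. by apply: Rmult_le_pos => //; apply/Rlt_le/exp_pos. Qed.

Lemma transient_le t : T <= t -> k t <= ka.
Proof.
move=> Tt; rewrite -[X in _ <= X]Rmult_1_r; apply: Rmult_le_compat_l => //.
rewrite -exp_0; have [e|e] := Req_dec (- la * (t - T)) 0; first by rewrite e; exact: Rle_refl.
by apply/Rlt_le/exp_increasing; have := Rmult_le_pos la (t - T) Hla ltac:(lra); lra.
Qed.

Lemma transient_start : k T = ka. Proof. by rewrite /k Rminus_diag_eq// Rmult_0_r exp_0 Rmult_1_r. Qed.

Lemma derivable_profile t : derivable_pt_lim g t (- la * k t).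
Proof.
have D1 : derivable_pt_lim (fun t => - la * (t - T)) t (- la).
  have := derivable_pt_lim_scal _ (- la) t _
    (derivable_pt_lim_minus _ _ _ _ _ (derivable_pt_lim_id t) (derivable_pt_lim_const T t)).
  by rewrite Rminus_0_r Rmult_1_r.
have D2 := derivable_pt_lim_comp _ _ _ _ _ D1 (derivable_pt_lim_exp _).
have D3 := derivable_pt_lim_plus _ _ _ _ _ (derivable_pt_lim_const ga t) (derivable_pt_lim_scal _ ka _ _ D2).
have -> : - la * k t = 0 + ka * (exp (- la * (t - T)) * - la) by rewrite /k; ring.
by apply: derivable_pt_lim_eq D3 => s.
Qed.

(* The barrier is v = (1 - c g) bu + c (g M + de), from above if c = 1 and from
   below if c = -1. *)
Lemma profile_touch c t1 x1 : T <= t1 -> c * c = 1 ->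
  let al t := 1 - c * g t in
  (forall x, Omega x -> c * (u x T - bu x) <= de + g T * (M - bu x)) ->
  (forall x t, boundary Omega x -> T <= t -> c * (u x t - bu x) <= de) ->
  clos Omega x1 -> de + g t1 * (M - bu x1) < c * (u x1 t1 - bu x1) ->
  exists x t, [/\ Omega x, T < t, 0 <= c * Ut x t + la * k t * (M - bu x) &
    forall xi, quad (fun i j => c * (S x t i j - al t * A x i j)) xi <= 0].
Proof.
move=> Tt1 cc al w0 wb cx1 w1.
have wE x t : c * (u x t - (al t * bu x + c * (g t * M + de))) =
    c * (u x t - bu x) - (c * c) * (de + g t * (M - bu x)) by rewrite /al; ring.
have Dal t : derivable_pt_lim al t (- (c * (- la * k t))).
  have := derivable_pt_lim_minus _ _ _ _ _ (derivable_pt_lim_const 1 t)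
    (derivable_pt_lim_scal _ c _ _ (derivable_profile t)).
  rewrite /Rminus Rplus_0_l; exact.
have Dbe t : derivable_pt_lim (fun t => c * (g t * M + de)) t (c * (- la * k t * M)).
  have := derivable_pt_lim_scal _ c _ _ (derivable_pt_lim_plus _ _ _ _ _
    (derivable_pt_lim_scal _ M _ _ (derivable_profile t)) (derivable_pt_lim_const de t)).
  rewrite Rplus_0_r Rmult_comm [M * _]Rmult_comm Rmult_comm; apply: derivable_pt_lim_eq => s.
  by rewrite /mult_real_fct /plus_fct /fct_cte; ring.
have [||||| x [t [Ox tT Dt Dx]]] := compare_touch (c := c) (T := T) (t1 := t1) (x1 := x1) _ Dal Dbe => //.
- lra.
- by move=> x Ox; rewrite wE cc; have := w0 x Ox; lra.
- move=> x t bx Tt; rewrite wE cc; have := wb x t bx Tt; have := HM (proj1 bx).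
  have gt0 : 0 <= g t by have := transient_ge0 t; rewrite /g; lra.
  by move=> hM; have := Rmult_le_pos (g t) (M - bu x) gt0 ltac:(lra); lra.
- by rewrite wE cc; lra.
exists x, t; split=> //; first lra.
have e : c * (- (c * (- la * k t)) * bu x + c * (- la * k t * M)) =
  (c * c) * (- (la * k t * (M - bu x))) by ring.
by move: Dt; rewrite Rmult_minus_distr_l e cc; lra.
Qed.

(** At a touching point W <= diag(s, al A) with al = 1 - ga - k and s = la k (M - bu), so
    monotonicity applies with W in the cone. Since s T_m(A) <= k f, the transient terms cancel and
    T_(m+1)(W) <= al^m (1 - ga) f <= (1 - ga) f, below the lower bound of the equation. The bound ga
    + ka <= 1 keeps al in [0, 1]. *)
Lemma barrier_above : ga + ka <= 1 -> INR m.+1 * h2 T < ga -> h1 T <= de ->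
  (forall x, Omega x -> u x T - bu x <= de + (ga + ka) * (M - bu x)) ->
  forall x t, clos Omega x -> T <= t -> u x t - bu x <= de + g t * (M - bu x).
Proof.
move=> gk h2T h1T w0 x1 t1 cx1 Tt1; apply: Rnot_lt_le => w1.
have [||||| x [t [Ox tT Dt Dx]]] := @profile_touch 1 t1 x1 Tt1; rewrite ?Rmult_1_l => //.
- by move=> x Ox; rewrite Rmult_1_l /g transient_start; exact: w0.
- move=> x t bx Tt; rewrite Rmult_1_l; have [_ h] := Hbdry bx (Rle_trans _ _ _ HT Tt).
  by have := h1_mono HT Tt; lra.
have cx := subset_clos Ox; have tt : t0 <= t by lra.
have kt := transient_ge0 t; have kt' := transient_le (Rlt_le _ _ tT).
set al := 1 - 1 * g t in Dx.
have al01 : 0 <= al <= 1 by rewrite /al /g; lra.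
have fx := A_pos cx (leqnn m.+1).
set s := la * k t * (M - bu x) in Dt.
have mono : Tp m.+1 (W x t) <= Tp m.+1 (bord s (fun i j => al * A x i j)).
  apply: Tp_bord_mono; [by apply: S_sym => //; lra | by move=> i j; rewrite (A_sym Ox) | lra |
    | exact: Hcone].
  move=> xi; rewrite (quadN (A := fun i j => 1 * (S x t i j - al * A x i j))).
    by have := Dx xi; lra.
  by move=> i j; ring.
have [lo _] := Heq Ox tt.
have h2t : INR m.+1 * h2 t <= INR m.+1 * h2 T.
  by apply: Rmult_le_compat_l; [exact: pos_INR | apply: h2_mono => //; lra].
have sT : s * Tp m (A x) <= k t * f x.
  have -> : s * Tp m (A x) = (la * k t) * ((M - bu x) * Tp m (A x)) by rewrite /s; ring.
  have lk : 0 <= la * k t by exact: Rmult_le_pos.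
  apply: Rle_trans (Rmult_le_compat_l _ _ _ lk (HL cx (leqnn m))) _.
  have -> : la * k t * (L * Tp m.+1 (A x)) = (la * L) * (k t * f x) by rewrite /f; ring.
  rewrite -[X in _ <= X]Rmult_1_l; apply: Rmult_le_compat_r => //.
  by apply: Rmult_le_pos => //; exact: Rlt_le.
move: mono; rewrite Tp_bord !Tp_scale => mono.
have alm : 0 <= al ^ m <= 1.
  split; first by apply: pow_le; lra.
  by rewrite -(pow1 m); apply: pow_incr.
have e : s * (al ^ m * Tp m (A x)) + al ^ m.+1 * Tp m.+1 (A x) = al ^ m * (s * Tp m (A x) + al * f x).
  by rewrite -tech_pow_Rmult /f; ring.
have b1 : s * Tp m (A x) + al * f x <= (1 - ga) * f x by rewrite /al /g; lra.
have b2 : al ^ m * (s * Tp m (A x) + al * f x) <= 1 * ((1 - ga) * f x).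
  apply: Rle_trans (Rmult_le_compat_l _ _ _ (proj1 alm) b1) _.
  apply: Rmult_le_compat_r; last exact: (proj2 alm).
  by apply: Rmult_le_pos; [lra | exact: Rlt_le].
have b3 : (1 - ga) * f x < (1 - INR m.+1 * h2 t) * f x by apply: Rmult_lt_compat_r => //; lra.
by move: mono lo; rewrite e; lra.
Qed.

(** Now diag(s, al A) is the smaller matrix, with s <= 0 and al = 1 + ga + k. [TpE] bounds each of
    its T_(p+1) below by (1 + ga) T_(p+1)(A): this puts it in the cone and, at p = m, contradicts
    the upper bound of the equation. Powers of al >= 1 only help. *)
Lemma barrier_below : INR m.+1 * hm T < ga -> hm T <= de ->
  (forall x, Omega x -> - (u x T - bu x) <= de + (ga + ka) * (M - bu x)) ->
  forall x t, clos Omega x -> T <= t -> - (u x t - bu x) <= de + g t * (M - bu x).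
Proof.
move=> hmT h1T w0 x1 t1 cx1 Tt1; apply: Rnot_lt_le => w1.
have [||||| x [t [Ox tT Dt Dx]]] := @profile_touch (-1) t1 x1 Tt1; try lra.
- by move=> x Ox; rewrite /g transient_start; have := w0 x Ox; lra.
- move=> x t bx Tt; have [h _] := Hbdry bx (Rle_trans _ _ _ HT Tt).
  by have := hm_mono HT Tt; lra.
- by [].
have cx := subset_clos Ox; have tt : t0 <= t by lra.
have kt := transient_ge0 t.
set al := 1 - -1 * g t in Dx.
have al1 : 1 <= al by rewrite /al /g; lra.
have fx := A_pos cx (leqnn m.+1).
set s := - (la * k t * (M - bu x)).
have pw p : 1 <= al ^ p by exact: pow_R1_Rle.
have TpE p : (p <= m)%N -> (1 + ga) * Tp p.+1 (A x) <= Tp p.+1 (bord s (fun i j => al * A x i j)).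
  move=> pm; have Tpos := A_pos cx (p := p.+1) pm.
  have sT : - (k t * Tp p.+1 (A x)) <= s * Tp p (A x).
    have -> : s * Tp p (A x) = - ((la * k t) * ((M - bu x) * Tp p (A x))) by rewrite /s; ring.
    apply: Ropp_le_contravar; have lk : 0 <= la * k t by exact: Rmult_le_pos.
    apply: Rle_trans (Rmult_le_compat_l _ _ _ lk (HL cx pm)) _.
    have -> : la * k t * (L * Tp p.+1 (A x)) = (la * L) * (k t * Tp p.+1 (A x)) by ring.
    rewrite -[X in _ <= X]Rmult_1_l; apply: Rmult_le_compat_r => //.
    by apply: Rmult_le_pos => //; exact: Rlt_le.
  rewrite Tp_bord !Tp_scale.
  have -> : s * (al ^ p * Tp p (A x)) + al ^ p.+1 * Tp p.+1 (A x) =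
    al ^ p * (s * Tp p (A x) + al * Tp p.+1 (A x)).
    by rewrite -tech_pow_Rmult; ring.
  have b1 : (1 + ga) * Tp p.+1 (A x) <= s * Tp p (A x) + al * Tp p.+1 (A x) by rewrite /al /g; lra.
  apply: Rle_trans (b1) _; rewrite -[X in X <= _]Rmult_1_l; apply: Rmult_le_compat_r => //.
  by apply: Rle_trans b1; apply: Rmult_le_pos; [lra | exact: Rlt_le].
have K : Km m.+1 (bord s (fun i j => al * A x i j)).
  move=> [//|p] _ pm; apply: Rlt_le_trans (TpE p pm).
  by apply: Rmult_lt_0_compat; [lra | exact: A_pos].
have mono : Tp m.+1 (bord s (fun i j => al * A x i j)) <= Tp m.+1 (W x t).
  apply: Tp_bord_mono => //; [by move=> i j; rewrite (A_sym Ox) |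
    by apply: S_sym => //; lra | rewrite /s; lra |].
  move=> xi; rewrite (quadN (A := fun i j => -1 * (S x t i j - al * A x i j))).
    by have := Dx xi; lra.
  by move=> i j; ring.
have [_ hi] := Heq Ox tt.
have hmt : INR m.+1 * hm t <= INR m.+1 * hm T.
  by apply: Rmult_le_compat_l; [exact: pos_INR | apply: hm_mono => //; lra].
have b3 : (1 + INR m.+1 * hm t) * f x < (1 + ga) * f x by apply: Rmult_lt_compat_r => //; lra.
by have := TpE m (leqnn m); rewrite -/(f x); lra.
Qed.
End Profile.

Hypothesis h2_pos : forall t, t0 <= t -> 0 < h2 t.
Hypothesis Hh2 : INR m.+1 * h2 t0 < 1.
Hypothesis Hinit : forall x, Omega x -> - hm t0 <= u x t0 - bu x <= h1 t0.

Lemma cont_bounded (h : point n -> R -> R) a b : a <= b ->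
  cont_on2 (fun x t => clos Omega x /\ a <= t <= b) h ->
  exists B, 0 <= B /\ forall x t, clos Omega x -> a <= t <= b -> Rabs (h x t) <= B.
Proof.
move=> ab C; have [x [t [cx tt H]]] := cont_on2_attains_max HObd Onemp ab C.
have C' : cont_on2 (fun x t => clos Omega x /\ a <= t <= b) (fun x t => 0 - h x t).
  by apply: cont_on2_minus => //; exact: cont_on2_const.
have [x' [t' [cx' tt' H']]] := cont_on2_attains_max HObd Onemp ab C'.
exists (Rmax (Rabs (h x t)) (Rabs (h x' t'))); split.
  exact: Rle_trans (Rabs_pos _) (Rmax_l _ _).
move=> y s cy ss; have := H y s cy ss; have := H' y s cy ss => l1 l2.
apply: Rabs_le; split.
  have := Rmax_r (Rabs (h x t)) (Rabs (h x' t')); have := Ropp_le_abs (h x' t'); lra.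
have := Rmax_l (Rabs (h x t)) (Rabs (h x' t')); have := Rle_abs (h x t); lra.
Qed.

Lemma bu_bounded : exists B, 0 <= B /\ forall x, clos Omega x -> Rabs (bu x) <= B.
Proof.
have [|B [B0 HB]] := @cont_bounded (fun x _ => bu x) 0 0 (Rle_refl 0).
  by apply: cont_on2_space Hbuc => x t [].
by exists B; split=> // x cx; apply: (HB x 0) => //; lra.
Qed.

Lemma gap_bounded : exists C, 0 <= C /\ forall x t, clos Omega x -> t0 <= t -> Rabs (u x t - bu x) <= C.
Proof.
have [B [B0 HB]] := bu_bounded.
have HM x : clos Omega x -> bu x <= B by move=> cx; apply: Rle_trans (Rle_abs _) (HB x cx).
have [L [L0 HL]] := ratio_bound HM.
have tt := Rle_refl t0; have p1 := h1_pos tt; have pm := hm_pos tt; have p2 := h2_pos tt.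
have m0 := pos_INR m.+1.
have mh2 : 0 <= INR m.+1 * h2 t0 by apply: Rmult_le_pos; lra.
have mhm : 0 <= INR m.+1 * hm t0 by apply: Rmult_le_pos; lra.
have m1 : 0 < INR m.+1 by apply: lt_0_INR; apply/ltP.
have mh2' : 0 < INR m.+1 * h2 t0 by exact: Rmult_lt_0_compat.
set K := INR m.+1 * hm t0 + 1.
exists (h1 t0 + hm t0 + K * (2 * B)); split.
  by have := Rmult_le_pos K (2 * B) ltac:(rewrite /K; lra) ltac:(lra); lra.
move=> x t cx t0t.
have bux : 0 <= B - bu x <= 2 * B.
  by have := HM x cx; have := Ropp_le_abs (bu x); have := HB x cx; lra.
(* Constant profile, ka = la = 0. Its value is the midpoint between (m+1) h2(t0) and 1, exceeding
   the first and staying below 1. *)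
have up := @barrier_above t0 ((INR m.+1 * h2 t0 + 1) / 2) 0 0 L B (h1 t0) tt ltac:(lra) ltac:(lra)
  ltac:(lra) HL ltac:(lra) HM ltac:(lra) ltac:(lra) ltac:(lra).
(* Again a constant profile; from below g may exceed 1, so K is simply (m+1) hm(t0) plus 1. *)
have lo := @barrier_below t0 K 0 0 L B (hm t0) tt ltac:(rewrite /K; lra) ltac:(lra)
  ltac:(lra) HL ltac:(lra) HM ltac:(rewrite /K; lra) ltac:(lra).
have KB : 1 * (B - bu x) <= K * (2 * B) by apply: Rmult_le_compat; rewrite /K; lra.
have KB' : K * (B - bu x) <= K * (2 * B) by apply: Rmult_le_compat_l; rewrite /K; lra.
apply: Rabs_le; split.
  have : - (u x t - bu x) <= hm t0 + K * (B - bu x); last lra.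
  have := lo _ x t cx t0t; rewrite Rmult_0_l Rplus_0_r; apply.
  move=> y Oy; have := Hinit Oy; have := HM y (subset_clos Oy) => hy.
  by have := Rmult_le_pos (K + 0) (B - bu y) ltac:(rewrite /K; lra) ltac:(lra); lra.
have : u x t - bu x <= h1 t0 + (INR m.+1 * h2 t0 + 1) / 2 * (B - bu x).
  have := up _ x t cx t0t; rewrite Rmult_0_l Rplus_0_r; apply.
  move=> y Oy; have := Hinit Oy; have := HM y (subset_clos Oy) => hy.
  by have := Rmult_le_pos ((INR m.+1 * h2 t0 + 1) / 2 + 0) (B - bu y) ltac:(lra) ltac:(lra); lra.
have : (INR m.+1 * h2 t0 + 1) / 2 * (B - bu x) <= 1 * (B - bu x) by apply: Rmult_le_compat_r; lra.
lra.
Qed.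

Lemma solution_bounded : exists K, forall x t, clos Omega x -> 0 <= t -> Rabs (u x t) <= K.
Proof.
have [C [C0 HC]] := gap_bounded; have [B [B0 HB]] := bu_bounded.
have [|K [K0 HK]] := @cont_bounded u 0 t0 ltac:(lra).
  by apply: cont_on2_sub Huc => x t [cx tt]; split=> //; lra.
exists (Rmax K (C + B)) => x t cx tp; case: (Rle_lt_dec t t0) => tt.
  by apply: Rle_trans (HK x t cx ltac:(lra)) _; exact: Rmax_l.
apply: Rle_trans (Rmax_r _ _); have -> : u x t = (u x t - bu x) + bu x by ring.
apply: Rle_trans (Rabs_triang _ _) _; apply: Rplus_le_compat; last exact: HB.
by apply: HC => //; exact: Rlt_le.
Qed.

(** The gap bound C is uniform in time, so M, V and L are fixed before T is chosen. The offset de,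
    the permanent part ga V and the transient part each contribute at most eps / 4. *)
Lemma solution_converges : tends_to_0_at_infty h1 -> tends_to_0_at_infty h2 -> tends_to_0_at_infty hm ->
  forall eps, 0 < eps -> exists T, forall t, T <= t ->
    forall x, clos Omega x -> Rabs (u x t - bu x) <= eps.
Proof.
move=> l1 l2 lm eps eps0.
have [C [C0 HC]] := gap_bounded; have [B [B0 HB]] := bu_bounded.
(* Chosen so that M - bu >= 2 C: the transient amplitude 1/2 then already covers the gap C at time
   T. *)
set M := B + 2 * C + 1.
have HM x : clos Omega x -> bu x <= M.
  by move=> cx; have := Rle_abs (bu x); have := HB x cx; rewrite /M; lra.
have [L [L0 HL]] := ratio_bound HM.
set V := 2 * B + 2 * C + 1.
have MV x : clos Omega x -> 2 * C <= M - bu x <= V.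
  by move=> cx; have := HB x cx; have := Rle_abs (bu x); have := Ropp_le_abs (bu x); rewrite /M /V; lra.
have V0 : 0 < V by rewrite /V; lra.
have m1 : 0 < INR m.+1 by apply: lt_0_INR; apply/ltP.
(* The first entry ensures ga + 1/2 <= 1, the second ga V <= eps / 4. *)
set ga := Rmin (1 / 2) (eps / (4 * V)).
have eV : 0 < eps / (4 * V) by apply: Rdiv_lt_0_compat; lra.
have ga0 : 0 < ga by apply: Rmin_glb_lt; lra.
have ga1 : ga <= 1 / 2 by exact: Rmin_l.
have gaV : ga * V <= eps / 4.
  apply: (Rle_trans _ (eps / (4 * V) * V)); first by apply: Rmult_le_compat_r; [lra | exact: Rmin_r].
  by right; field; lra.
have gm0 : 0 < ga / INR m.+1 by exact: Rdiv_lt_0_compat.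
have [T1 H1] := l1 (eps / 4) ltac:(lra).
have [T2 H2] := l2 _ gm0.
have [T3 H3] := lm (Rmin (eps / 4) (ga / INR m.+1)) ltac:(apply: Rmin_glb_lt; lra).
set T := Rmax t0 (Rmax T1 (Rmax T2 T3)).
have Tt0 : t0 <= T by exact: Rmax_l.
have TT1 : T1 <= T by apply: Rle_trans (Rmax_r _ _); exact: Rmax_l.
have TT2 : T2 <= T by apply: Rle_trans (Rmax_r _ _); apply: Rle_trans (Rmax_r _ _); exact: Rmax_l.
have TT3 : T3 <= T by apply: Rle_trans (Rmax_r _ _); apply: Rle_trans (Rmax_r _ _); exact: Rmax_r.
have b1 : h1 T <= eps / 4 by have := H1 T TT1; have := Rle_abs (h1 T); lra.
have mlt r : r < ga / INR m.+1 -> INR m.+1 * r < ga.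
  move=> h; have -> : ga = INR m.+1 * (ga / INR m.+1) by field; lra.
  exact: Rmult_lt_compat_l.
have b2 : INR m.+1 * h2 T < ga by apply: mlt; have := H2 T TT2; have := Rle_abs (h2 T); lra.
have h3 := H3 T TT3; have h3' := Rle_abs (hm T).
have b3 : INR m.+1 * hm T < ga by apply: mlt; have := Rmin_r (eps / 4) (ga / INR m.+1); lra.
have b4 : hm T <= eps / 4 by have := Rmin_l (eps / 4) (ga / INR m.+1); lra.
set la := / (L + 1).
have la0 : 0 < la by apply: Rinv_0_lt_compat; lra.
have laL : la * L <= 1.
  have e : la * (L + 1) = 1 by rewrite /la; field; lra.
  by rewrite Rmult_plus_distr_l in e; lra.
have up := @barrier_above T ga (1 / 2) la L M (eps / 4) Tt0 ga0 ltac:(lra)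
  ltac:(lra) HL laL HM ltac:(lra) b2 b1.
have lo := @barrier_below T ga (1 / 2) la L M (eps / 4) Tt0 ga0 ltac:(lra)
  ltac:(lra) HL laL HM b3 b4.
have init x : Omega x -> C <= (ga + 1 / 2) * (M - bu x).
  move=> Ox; have [MVx _] := MV x (subset_clos Ox).
  have := Rmult_le_compat_r (M - bu x) (1 / 2) (ga + 1 / 2) ltac:(lra) ltac:(lra); lra.
(* After this waiting time the exponential is at most eps / (2 V), so the transient part is at most
   eps / 4. *)
exists (T + Rabs (ln (eps / (2 * V))) / la) => t Tt x cx.
have eV2 : 0 < eps / (2 * V) by apply: Rdiv_lt_0_compat; lra.
have q0 : 0 <= Rabs (ln (eps / (2 * V))) / la.
  by apply: Rmult_le_pos; [exact: Rabs_pos | exact/Rlt_le/Rinv_0_lt_compat].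
have decay : 1 / 2 * exp (- la * (t - T)) * V <= eps / 4.
  have le1 : exp (- la * (t - T)) <= eps / (2 * V).
    rewrite -[X in _ <= X]exp_ln//.
    have le2 : - la * (t - T) <= ln (eps / (2 * V)).
      have := Rmult_le_compat_l la _ (t - T) ltac:(lra) (_ : Rabs (ln (eps / (2 * V))) / la <= t - T).
      have -> : la * (Rabs (ln (eps / (2 * V))) / la) = Rabs (ln (eps / (2 * V))) by field; lra.
      by move=> /(_ ltac:(lra)); have := Ropp_le_abs (ln (eps / (2 * V))); lra.
    by case: le2 => [h|->]; [apply/Rlt_le/exp_increasing | exact: Rle_refl].
  have -> : eps / 4 = 1 / 2 * (eps / (2 * V)) * V by field; lra.
  by apply: Rmult_le_compat_r; [lra | apply: Rmult_le_compat_l; lra].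
have TT : T <= t by lra.
have [MVx0 MVx] := MV x cx.
have e0 := exp_pos (- la * (t - T)).
have tot : (ga + 1 / 2 * exp (- la * (t - T))) * (M - bu x) <= eps / 2.
  apply: (Rle_trans _ ((ga + 1 / 2 * exp (- la * (t - T))) * V)); last by lra.
  by apply: Rmult_le_compat_l; lra.
apply: Rabs_le; split.
  have : - (u x t - bu x) <= eps / 4 + (ga + 1 / 2 * exp (- la * (t - T))) * (M - bu x); last lra.
  apply: lo => // y Oy; have := HC y T (subset_clos Oy) Tt0; have := Ropp_le_abs (u y T - bu y).
  by have := init y Oy; lra.
have : u x t - bu x <= eps / 4 + (ga + 1 / 2 * exp (- la * (t - T))) * (M - bu x); last lra.
apply: up => // y Oy; have := HC y T (subset_clos Oy) Tt0; have := Rle_abs (u y T - bu y).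
by have := init y Oy; lra.
Qed.
End Barrier.
End Evolution.

Theorem theorem5p3
  (n m : nat) (Omega : point n -> Prop)
  (HOm : is_domain Omega) (HObd : is_bounded Omega)
  (Hm1 : (1 <= m)%nat) (Hmn : (m <= n)%nat)
  (* bu in C^2(clos Omega): derivatives on Omega extending continuously *)
  (bu : point n -> R) (bD1 : 'I_n -> point n -> R) (bD2 : 'I_n -> 'I_n -> point n -> R)
  (Hbu1 : forall i x, Omega x -> derivable_pt_lim (fun s => bu (upd x i s)) (x i) (bD1 i x))
  (Hbu2 : forall i j x, Omega x ->
            derivable_pt_lim (fun s => bD1 i (upd x j s)) (x j) (bD2 i j x))
  (Hbuc : cont_on (clos Omega) bu)
  (Hbuc1 : forall i, cont_on (clos Omega) (bD1 i))
  (Hbuc2 : forall i j, cont_on (clos Omega) (bD2 i j))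
  (* bu is m-admissible *)
  (Hadm : forall x, clos Omega x -> Km m (fun i j => bD2 i j x))
  (* u in C^{2,1}(Q) /\ C(clos Omega x [0,oo)) *)
  (u : point n -> R -> R) (Ut : point n -> R -> R)
  (Ux : 'I_n -> point n -> R -> R) (Uxx : 'I_n -> 'I_n -> point n -> R -> R)
  (Huc : cont_on2 (fun x t => clos Omega x /\ 0 <= t) u)
  (Hut : forall x t, Omega x -> 0 < t -> derivable_pt_lim (fun s => u x s) t (Ut x t))
  (Hux : forall i x t, Omega x -> 0 < t ->
           derivable_pt_lim (fun s => u (upd x i s) t) (x i) (Ux i x t))
  (Huxx : forall i j x t, Omega x -> 0 < t ->
           derivable_pt_lim (fun s => Ux i (upd x j s) t) (x j) (Uxx i j x t))
  (Hutc : cont_on2 (fun x t => Omega x /\ 0 < t) Ut)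
  (Huxc : forall i, cont_on2 (fun x t => Omega x /\ 0 < t) (Ux i))
  (Huxxc : forall i j, cont_on2 (fun x t => Omega x /\ 0 < t) (Uxx i j))
  (x0 : point n) (t0 : R) (Hx0 : Omega x0) (Ht0 : 0 < t0)
  (Hpos0 : Km m (fun i j => Uxx i j x0 t0))
  (nu mu : R) (Hnu : 0 < nu) (Hnumu : nu <= mu)
  (HE : forall x t, Omega x -> t0 <= t ->
          let Em := - Ut x t * Tp (m - 1)%nat (fun i j => Uxx i j x t)
                    + Tp m (fun i j => Uxx i j x t) in
          nu <= Em <= mu)
  (h1 h2 hm : R -> R)
  (Hhc : forall h, h = h1 \/ h = h2 \/ h = hm ->
     (forall t, t0 <= t -> 0 < h t) /\
     (forall s t, t0 <= s -> s <= t -> h t <= h s) /\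
     (forall t, t0 <= t -> forall eps, 0 < eps -> exists delta, 0 < delta /\
        forall s, t0 <= s -> Rabs (s - t) < delta -> Rabs (h s - h t) < eps))
  (Hh2 : h2 t0 < / INR m)
  (Hinit : forall x, Omega x -> - hm t0 <= u x t0 - bu x <= h1 t0)
  (Hbdry : forall x t, boundary Omega x -> t0 <= t -> - hm t <= u x t - bu x <= h1 t)
  (Heq : forall x t, Omega x -> t0 <= t ->
          let Em := - Ut x t * Tp (m - 1)%nat (fun i j => Uxx i j x t)
                    + Tp m (fun i j => Uxx i j x t) in
          let f := Tp m (fun i j => bD2 i j x) in
          - hm t <= / INR m * (1 - Em / f) <= h2 t) :
  (exists M, forall x t, clos Omega x -> 0 <= t -> Rabs (u x t) <= M) /\
  (tends_to_0_at_infty h1 -> tends_to_0_at_infty h2 -> tends_to_0_at_infty hm ->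
   forall eps, 0 < eps -> exists T, forall t, T <= t ->
     forall x, clos Omega x -> Rabs (u x t - bu x) <= eps).
Proof.
case: m Hm1 Hmn Hadm Hpos0 HE Hh2 Heq => // m' _ _ Hadm' Hpos HE' Hh2' Heq'.
have EmE x t : - Ut x t * Tp (m'.+1 - 1)%nat (fun i j => Uxx i j x t) +
    Tp m'.+1 (fun i j => Uxx i j x t) = Tp m'.+1 (bord (- Ut x t) (fun i j => Uxx i j x t)).
  by rewrite Tp_bord subn1.
have m0 : 0 < INR m'.+1 by apply: lt_0_INR; apply/ltP.
have Hux' t : 0 < t -> has_partials Omega (fun x => u x t) (fun i x => Ux i x t).
  by move=> t0' i x Ox; exact: Hux.
have Huxx' i t : 0 < t -> has_partials Omega (fun x => Ux i x t) (fun j x => Uxx i j x t).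
  by move=> t0' j x Ox; exact: Huxx.
have Hbu2' i : has_partials Omega (bD1 i) (bD2 i) by move=> j x Ox; exact: Hbu2.
have Hcone := W_in_cone HOm Hux' Huxx' Hutc Huxxc Hx0 Ht0 Hpos Hnu
  (fun x t Ox tt => eq_rect _ (fun r => nu <= r) (proj1 (HE' x t Ox tt)) _ (EmE x t)).
(* The hypothesis on 1 - E_m / f with quotients cleared; f > 0 by admissibility. *)
have Hf x t : Omega x -> t0 <= t ->
    (1 - INR m'.+1 * h2 t) * Tp m'.+1 (fun i j => bD2 i j x) <=
      Tp m'.+1 (bord (- Ut x t) (fun i j => Uxx i j x t)) <=
    (1 + INR m'.+1 * hm t) * Tp m'.+1 (fun i j => bD2 i j x).
  move=> Ox tt; have := Heq' x t Ox tt; cbv zeta; rewrite EmE.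
  have f0 : 0 < Tp m'.+1 (fun i j => bD2 i j x) by apply: (Hadm' x (subset_clos Ox)).
  move: f0; set f := Tp m'.+1 (fun i j => bD2 i j x); set E := Tp m'.+1 (bord _ _) => f0 [lo up].
  have e r : r = INR m'.+1 * (/ INR m'.+1 * r) by field; lra.
  have lo' := Rmult_le_compat_l _ _ _ (Rlt_le _ _ m0) lo.
  have up' := Rmult_le_compat_l _ _ _ (Rlt_le _ _ m0) up.
  rewrite -e in lo'; rewrite -e in up'.
  have Ef : E = E / f * f by field; lra.
  by split; rewrite {1}Ef; apply: Rmult_le_compat_r; lra.
have [p1 [mono1 _]] := Hhc h1 (or_introl erefl).
have [p2 [mono2 _]] := Hhc h2 (or_intror (or_introl erefl)).
have [pm [monom _]] := Hhc hm (or_intror (or_intror erefl)).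
have Hh : INR m'.+1 * h2 t0 < 1.
  by rewrite -(Rinv_r (INR m'.+1)); [exact: Rmult_lt_compat_l | lra].
split.
  exact: (solution_bounded HOm HObd Hbu1 Hbu2' Hbuc Hbuc1 Hbuc2 Hadm' Huc Hut Hux' Huxx' Huxc Huxxc
    Ht0 Hcone p1 pm mono1 mono2 monom Hbdry Hf p2 Hh Hinit).
exact: (solution_converges HOm HObd Hbu1 Hbu2' Hbuc Hbuc1 Hbuc2 Hadm' Huc Hut Hux' Huxx' Huxc Huxxc
  Ht0 Hcone p1 pm mono1 mono2 monom Hbdry Hf p2 Hh Hinit).
Qed.
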